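(* Let $\nu>0$, $b\ge0$, $a,c\in\mathbb{R}$, $x_0^2:=a^2+4\nu b$, $k_m\ge0$, $\omega_m>0$ fixed, and $D^\infty=\{(\omega,k):\omega_m\le|\omega|<+\infty,\ k_m\le|k|<+\infty\}$. For small overlap $L>0$ the Ventcel best approximation problem $$\inf_{(p,q)\in\mathbb{C}^2}\sup_{(\omega,k)\in D^\infty}|\rho(\omega,k,p,q,L)|$$ has a unique solution $(p_{1,\infty}^*(L),q_{1,\infty}^*(L))$ with minimal value $\delta_{1,\infty}^*(L)$, and as $L\to0$ $$p_{1,\infty}^*(L)\sim\frac12\sqrt[5]{\frac{\nu A^4}{8L}},\qquad q_{1,\infty}^*(L)\sim4\sqrt[5]{\frac{\nu^2L^3}{2A^2}},\qquad \delta_{1,\infty}^*(L)\sim1-\frac{A}{2p_{1,\infty}^*(L)},$$ where $A$ is the constant defined in the context.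
   Context: This concerns the optimized Schwarz waveform relaxation algorithm for $\partial_t u+(a,c)\cdot\nabla u-\nu\Delta u+bu=f$ on $\mathbb{R}^2$, decomposed into $\Omega_1=(-\infty,L)\times\mathbb{R}$ and $\Omega_2=(0,\infty)\times\mathbb{R}$ ($L\ge0$ the overlap), with Ventcel transmission operators $(\nu\nabla-\tfrac{(a,c)^T}{2})\cdot n_i+\tfrac{s}{2}$, $s=p+q(\partial_t+c\partial_y-\nu\Delta_y)$; its convergence factor in Fourier variables $(\omega,k)$ is $$\rho(\omega,k,p,q,L)=\frac{p+q(\nu k^2+i(\omega+ck))-\sqrt{x_0^2+4\nu(\nu k^2+i(\omega+ck))}}{p+q(\nu k^2+i(\omega+ck))+\sqrt{x_0^2+4\nu(\nu k^2+i(\omega+ck))}}\,e^{-\frac{L}{2\nu}\sqrt{x_0^2+4\nu(\nu k^2+i(\omega+ck))}},$$ with $\sqrt{\cdot}$ the branch with positive real part. Define $$\bar k=|c|\frac{\sqrt{(c^2+x_0^2)^2+16\nu^2\omega_m^2}-(c^2+x_0^2)}{8\nu^2\omega_m},\qquad \varphi(k,\xi)=2\sqrt2\sqrt{\sqrt{(x_0^2+4\nu^2k^2)^2+16\nu^2\xi^2}+x_0^2+4\nu^2k^2},$$ and $A=\varphi(\bar k,-\omega_m+|c|\bar k)$ if $k_m\le\bar k$; $A=\varphi(k_m,-\omega_m+|c|k_m)$ if $\bar k\le k_m\le\omega_m/|c|$; $A=\varphi(k_m,0)$ if $k_m\ge\omega_m/|c|$. Standing assumption: either $x_0^2+4\nu^2k_m^2\ne0$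 or $\omega_m\ne0$. $\sim$ denotes asymptotic equivalence as $L\to0$. *)

(* Defs.v *)
From Stdlib Require Import Reals.
From Coquelicot Require Import Coquelicot.
Open Scope R_scope.

(* Principal square root: the branch with nonnegative (positive off the
   negative real axis) real part. *)
Definition csqrt (z : C) : C :=
  let r := Cmod z in
  (sqrt ((r + Re z) / 2),
   (if Rle_dec 0 (Im z) then 1 else -1) * sqrt ((r - Re z) / 2)).

Definition cexp (z : C) : C :=
  (exp (Re z) * cos (Im z), exp (Re z) * sin (Im z)).

Definition x0sq (nu a b : R) : R := a ^ 2 + 4 * nu * b.

Definition zsym (nu c w k : R) : C := (nu * k ^ 2, w + c * k).

Definition root_sym (nu a b c w k : R) : C :=
  csqrt (RtoC (x0sq nu a b) + RtoC (4 * nu) * zsym nu c w k)%C.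

Definition rho (nu a b c : R) (w k : R) (p q : C) (L : R) : C :=
  let S := root_sym nu a b c w k in
  ((p + q * zsym nu c w k - S) / (p + q * zsym nu c w k + S)
   * cexp (RtoC (- (L / (2 * nu))) * S))%C.

Definition InD (km wm : R) (w k : R) : Prop :=
  wm <= Rabs w /\ km <= Rabs k.

Definition kbar (nu a b c wm : R) : R :=
  let s := c ^ 2 + x0sq nu a b in
  Rabs c * (sqrt (s ^ 2 + 16 * nu ^ 2 * wm ^ 2) - s) / (8 * nu ^ 2 * wm).

Definition phi (nu a b : R) (k xi : R) : R :=
  let t := x0sq nu a b + 4 * nu ^ 2 * k ^ 2 in
  2 * sqrt 2 * sqrt (sqrt (t ^ 2 + 16 * nu ^ 2 * xi ^ 2) + t).

(* The constant A.  The middle case "kbar <= km <= wm/|c|" is written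
   km * |c| <= wm, which agrees for c <> 0 and gives wm/|c| = +oo for c = 0. *)
Definition Aconst (nu a b c km wm : R) : R :=
  let kb := kbar nu a b c wm in
  if Rle_dec km kb then phi nu a b kb (- wm + Rabs c * kb)
  else if Rle_dec (km * Rabs c) wm then phi nu a b km (- wm + Rabs c * km)
  else phi nu a b km 0.

(* Main.v *)
Require Import Defs.
From Stdlib Require Import Reals Lra Psatz Lia ClassicalEpsilon.
From Coquelicot Require Import Coquelicot.
Open Scope R_scope.

(* Put [S = x + iy] for the square root of the symbol, [P = p - q x0^2 / (4 nu)], [Q = q / (4 nu)]
   and [l = L / (2 nu)], so that [rho = (g - S) / (g + S) * exp (- l S)] with [g = P + Q S^2].
   For [d = exp (- eta)] the constraint [|rho| <= d] at a point with [l x < eta] confines [g] to a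
   disk, hence is convex in [(P, Q)]; at a point with [l x >= eta] it holds automatically when [P]
   and [Q] are real and positive.  So one may keep only the convex constraints.  They are invariant
   under complex conjugation, their optimum is attained by compactness, and it is unique and real:
   the midpoint of two optima satisfies strictly all constraints except possibly that at the single
   [S] where both give the same [g], and a small perturbation relaxes this one too.

   With [m = A / 4 = min Re S] and [l = h^5 / (64 m)], the pair [P = 2m/h], [Q = h^3/(16m)] is
   feasible for [eta = (1 - eps) h].  Conversely, the constraints at the three points
   [x = m], [4m/h^2], [32m/h^4] (at the last two [|arg S|] is close to [pi/4]) force every real
   solution with [eta >= (1 - eps) h] to be close to that pair, and [eta] to be close to [h]. *)

(** The fifth root and the three test points come from balancing three local minima of [- ln |rho|],
    taken to leading order. Near [Re S = m] the term [P] dominates [g], [|g|] is much larger than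
    [|S|], and the value is [2m/P]. In the middle range [|S|] is much larger than [|g|]; with
    [|arg S|] near [pi/4] the value is [(P + 2 Q x^2)/x], least at [x = sqrt (P/(2Q))], where it
    equals [2 sqrt (2PQ)]. In the far range [g] is close to [Q S^2] and again dominates [S]; the
    value is [1/(Qx) + l x], least at [x = 1/sqrt (Q l)], where it equals [2 sqrt (l/Q)]. Equating
    the three minima to [h] gives [P h = 2m], [8PQ = h^2] and [Q h^2 = 4l], which is the scaled
    pair; the last two minimisers become [4m/h^2] and [32m/h^4]. Since [eta] is of the order of [h],
    the exponentials can be traded for polynomials at a relative cost [O(h)], and the estimates
    become polynomial inequalities. *)

(** * Limits and subsequences of real sequences *)

Lemma bounded_subsequence (u : nat -> R) (B : R) :
  (forall n, Rabs (u n) <= B) ->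
  exists (phi : nat -> nat) (l : R),
    filterlim phi eventually eventually /\
    is_lim_seq (fun n => u (phi n)) l.
Proof.
  intros HB.
  destruct (Bolzano_Weierstrass u (fun x => -B <= x <= B)) as [l Hl].
  { apply compact_P3. }
  { intros n; apply Rabs_le_between; apply HB. }
  assert (Hc : forall N n : nat, exists p, (N < p)%nat /\ Rabs (u p - l) < / (INR n + 1)).
  { intros N n.
    assert (Hn : 0 < / (INR n + 1)) by (apply Rinv_0_lt_compat; pose proof (pos_INR n); lra).
    destruct (Hl (fun x => Rabs (x - l) < / (INR n + 1)) (S N)) as [p [Hp1 Hp2]].
    - exists (mkposreal _ Hn). intros x Hx; exact Hx.
    - exists p; split; [lia | exact Hp2]. }
  set (next := fun N n => proj1_sig (constructive_indefinite_description _ (Hc N n))).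
  assert (Hnext : forall N n, (N < next N n)%nat /\ Rabs (u (next N n) - l) < / (INR n + 1)).
  { intros N n; unfold next; destruct constructive_indefinite_description; auto. }
  set (phi := fix phi n := match n with O => next O O | S m => next (phi m) (S m) end).
  exists phi, l; split.
  - apply eventually_subseq. intros n; simpl; apply Hnext.
  - assert (Hphi : forall n, Rabs (u (phi n) - l) < / (INR n + 1)).
    { intros [|n]; apply Hnext. }
    apply is_lim_seq_spec. intros eps.
    destruct (archimed_cor1 eps (cond_pos eps)) as [N [HN1 HN2]].
    exists N. intros n Hn. eapply Rlt_trans; [apply Hphi|].
    eapply Rle_lt_trans; [|apply HN1].
    assert (0 < INR N) by (apply lt_0_INR; lia).
    assert (INR N <= INR n) by (apply le_INR; lia).
    apply Rinv_le_contravar; lra.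
Qed.

Lemma bounded_subsequence2 (u v : nat -> R) (B : R) :
  (forall n, Rabs (u n) <= B) -> (forall n, Rabs (v n) <= B) ->
  exists (phi : nat -> nat) (l l' : R),
    filterlim phi eventually eventually /\
    is_lim_seq (fun n => u (phi n)) l /\ is_lim_seq (fun n => v (phi n)) l'.
Proof.
  intros Hu Hv.
  destruct (bounded_subsequence u B Hu) as [f [l [Hf Hl]]].
  destruct (bounded_subsequence (fun n => v (f n)) B (fun n => Hv (f n))) as [g [l' [Hg Hl']]].
  exists (fun n => f (g n)), l, l'; repeat split.
  - eapply filterlim_comp; eauto.
  - apply (is_lim_seq_subseq (fun n => u (f n)) l g Hg Hl).
  - exact Hl'.
Qed.

Lemma is_lim_seq_nonneg (u : nat -> R) (l : R) :
  eventually (fun n => 0 <= u n) -> is_lim_seq u l -> 0 <= l.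
Proof.
  intros H Hl.
  apply (is_lim_seq_le_loc (fun _ => 0) u 0 l H); [apply is_lim_seq_const | exact Hl].
Qed.

Lemma is_lim_seq_inv_succ : is_lim_seq (fun n => / (INR n + 1)) 0.
Proof.
  replace (Finite 0) with (Rbar_inv p_infty) by reflexivity.
  apply is_lim_seq_inv; [|easy].
  eapply is_lim_seq_plus; [apply is_lim_seq_INR | apply is_lim_seq_const | easy].
Qed.

Lemma is_lim_seq_eventually_lt (u : nat -> R) (l M : R) :
  is_lim_seq u l -> l < M -> eventually (fun n => u n < M).
Proof.
  intros Hu Hl. apply is_lim_seq_spec in Hu.
  assert (He : 0 < M - l) by lra.
  destruct (Hu (mkposreal _ He)) as [N HN]. exists N; intros n Hn.
  specialize (HN n Hn); simpl in HN. apply Rabs_def2 in HN; lra.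
Qed.

(** Works structurally on the expression: the target limit has to be the same expression with every
    sequence replaced by its limit, whence the unsimplified targets such as [eta + 0 * 0 - l * X]
    further on. *)
Ltac lim :=
  match goal with
  | |- is_lim_seq (fun n => exp (@?u n)) _ => apply (is_lim_seq_continuous exp u); [apply derivable_continuous_pt, derivable_pt_exp | lim]
  | |- is_lim_seq (fun n => @?u n + @?v n) _ => apply (is_lim_seq_plus' u v); lim
  | |- is_lim_seq (fun n => @?u n - @?v n) _ => apply (is_lim_seq_minus' u v); lim
  | |- is_lim_seq (fun n => @?u n * @?v n) _ => apply (is_lim_seq_mult' u v); lim
  | |- is_lim_seq (fun n => @?u n ^ 2) _ =>
      apply (is_lim_seq_ext (fun n => u n * (u n * 1))); [intros; reflexivity | lim]
  | |- _ => first [eassumption | apply is_lim_seq_const]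
  end.

(** * The constraint at one point: convexity, symmetry and polynomial form *)

(* With [S = x + iy], [g = P + Q S^2] ([P = P1 + i P2], [Q = Q1 + i Q2]), this is
   [E |g + S|^2 - |g - S|^2]: the bound [|rho| <= exp (-eta)] says that it is
   nonnegative for [E = exp (-2 (eta - l x))], [l = L / (2 nu)]. *)
Definition gre (x y P1 Q1 Q2 : R) : R := P1 + Q1 * (x * x - y * y) - Q2 * (2 * (x * y)).
Definition gim (x y P2 Q1 Q2 : R) : R := P2 + Q1 * (2 * (x * y)) + Q2 * (x * x - y * y).

Definition gap (E x y P1 P2 Q1 Q2 : R) : R :=
  E * ((gre x y P1 Q1 Q2 + x) * (gre x y P1 Q1 Q2 + x)
       + (gim x y P2 Q1 Q2 + y) * (gim x y P2 Q1 Q2 + y))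
  - ((gre x y P1 Q1 Q2 - x) * (gre x y P1 Q1 Q2 - x)
     + (gim x y P2 Q1 Q2 - y) * (gim x y P2 Q1 Q2 - y)).

Definition feas (Sset : R -> R -> Prop) (l eta P1 P2 Q1 Q2 : R) : Prop :=
  forall x y, Sset x y -> l * x < eta ->
    0 <= gap (exp (- 2 * (eta - l * x))) x y P1 P2 Q1 Q2.

Lemma sum_sqr_nonneg (u v : R) : 0 <= u * u + v * v.
Proof. pose proof (Rle_0_sqr u); pose proof (Rle_0_sqr v); unfold Rsqr in *; lra. Qed.

Lemma gap_expand (E x y P1 P2 Q1 Q2 : R) :
  gap E x y P1 P2 Q1 Q2 =
  2 * (1 + E) * (gre x y P1 Q1 Q2 * x + gim x y P2 Q1 Q2 * y)
  - (1 - E) * (gre x y P1 Q1 Q2 * gre x y P1 Q1 Q2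
               + gim x y P2 Q1 Q2 * gim x y P2 Q1 Q2 + x * x + y * y).
Proof. unfold gap; ring. Qed.

Lemma gap_real (E x y P Q : R) :
  gap E x y P 0 Q 0 =
  2 * (1 + E) * (x * (P + Q * (x * x + y * y)))
  - (1 - E) * (P * P + 2 * P * Q * (x * x - y * y)
               + Q * Q * ((x * x + y * y) * (x * x + y * y)) + (x * x + y * y)).
Proof. unfold gap, gre, gim; ring. Qed.

(** For fixed [S] and [E], [gap] is quadratic in [g] with leading term [- (1 - E) |g|^2]. The last
    term is the exact gain from concavity; for [E < 1] and [0 < s < 1] it vanishes only where both
    pairs give the same [g], which is what uniqueness exploits. *)
Lemma gap_convex_comb (E x y s P1 P2 Q1 Q2 P1' P2' Q1' Q2' : R) :
  gap E x y ((1 - s) * P1 + s * P1') ((1 - s) * P2 + s * P2')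
            ((1 - s) * Q1 + s * Q1') ((1 - s) * Q2 + s * Q2') =
  (1 - s) * gap E x y P1 P2 Q1 Q2 + s * gap E x y P1' P2' Q1' Q2'
  + s * (1 - s) * (1 - E) *
    (gre x y (P1 - P1') (Q1 - Q1') (Q2 - Q2') * gre x y (P1 - P1') (Q1 - Q1') (Q2 - Q2')
     + gim x y (P2 - P2') (Q1 - Q1') (Q2 - Q2') * gim x y (P2 - P2') (Q1 - Q1') (Q2 - Q2')).
Proof. unfold gap, gre, gim; ring. Qed.

Lemma gap_conj (E x y P1 P2 Q1 Q2 : R) :
  gap E x y P1 (- P2) Q1 (- Q2) = gap E x (- y) P1 P2 Q1 Q2.
Proof. unfold gap, gre, gim; ring. Qed.

Lemma gap_mono (E E' x y P1 P2 Q1 Q2 : R) :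
  E <= E' -> gap E x y P1 P2 Q1 Q2 <= gap E' x y P1 P2 Q1 Q2.
Proof.
  intros HE; unfold gap. set (u := gre _ _ _ _ _); set (v := gim _ _ _ _ _).
  assert (0 <= (E' - E) * ((u + x) * (u + x) + (v + y) * (v + y))) by
    (apply Rmult_le_pos; [lra | apply sum_sqr_nonneg]).
  lra.
Qed.

Lemma exp_neg_lt_1 (u : R) : 0 < u -> exp (- 2 * u) < 1.
Proof. intros Hu. rewrite <- exp_0. apply exp_increasing; lra. Qed.

Lemma feas_mono (Sset : R -> R -> Prop) (l eta eta' P1 P2 Q1 Q2 : R) :
  eta' <= eta -> feas Sset l eta P1 P2 Q1 Q2 -> feas Sset l eta' P1 P2 Q1 Q2.
Proof.
  intros He HF x y HS Hx.
  eapply Rle_trans; [apply (HF x y HS); lra|].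
  apply gap_mono.
  destruct (Req_dec eta eta') as [->|Hne]; [lra|].
  left; apply exp_increasing; lra.
Qed.

Lemma feas_midpoint (Sset : R -> R -> Prop) (l eta P1 P2 Q1 Q2 P1' P2' Q1' Q2' : R) :
  feas Sset l eta P1 P2 Q1 Q2 -> feas Sset l eta P1' P2' Q1' Q2' ->
  feas Sset l eta ((1 - /2) * P1 + /2 * P1') ((1 - /2) * P2 + /2 * P2')
            ((1 - /2) * Q1 + /2 * Q1') ((1 - /2) * Q2 + /2 * Q2').
Proof.
  intros H H' x y HS Hx. rewrite gap_convex_comb.
  specialize (H x y HS Hx); specialize (H' x y HS Hx).
  pose proof (exp_neg_lt_1 (eta - l * x) ltac:(lra)).
  set (u := gre _ _ _ _ _); set (v := gim _ _ _ _ _).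
  assert (0 <= /2 * (1 - /2) * (1 - exp (- 2 * (eta - l * x))) * (u * u + v * v)) by
    (apply Rmult_le_pos; [lra | apply sum_sqr_nonneg]).
  lra.
Qed.

Lemma feas_conj (Sset : R -> R -> Prop) (l eta P1 P2 Q1 Q2 : R) :
  (forall x y, Sset x y -> Sset x (- y)) ->
  feas Sset l eta P1 P2 Q1 Q2 -> feas Sset l eta P1 (- P2) Q1 (- Q2).
Proof. intros Hc HF x y HS Hx. rewrite gap_conj. apply HF; auto. Qed.

(** A feasible pair is averaged with its conjugate. All quantitative estimates can thereby be made
    for real coefficients. *)
Lemma feas_real_part (Sset : R -> R -> Prop) (l eta P1 P2 Q1 Q2 : R) :
  (forall x y, Sset x y -> Sset x (- y)) ->
  feas Sset l eta P1 P2 Q1 Q2 -> feas Sset l eta P1 0 Q1 0.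
Proof.
  intros Hc HF.
  pose proof (feas_midpoint _ _ _ _ _ _ _ _ _ _ _ HF (feas_conj _ _ _ _ _ _ _ Hc HF)) as HM.
  replace P1 with ((1 - /2) * P1 + /2 * P1) by field.
  replace Q1 with ((1 - /2) * Q1 + /2 * Q1) by field.
  replace 0 with ((1 - /2) * P2 + /2 * - P2) at 1 by field.
  replace 0 with ((1 - /2) * Q2 + /2 * - Q2) by field.
  exact HM.
Qed.

(** [Re (g conj S) = x (P + Q |S|^2)] is positive, so [|g - S| < |g + S|]: the constraints dropped
    from [feas] hold by themselves. *)
Lemma gap_real_pos_of_ge1 (E x y P Q : R) :
  1 <= E -> 0 < x -> y * y <= x * x -> 0 < P -> 0 < Q -> 0 < gap E x y P 0 Q 0.
Proof.
  intros HE Hx Hy HP HQ. rewrite gap_real.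
  assert (HPQ : 0 < P * Q) by nra.
  assert (0 < x * (P + Q * (x * x + y * y))) by (apply Rmult_lt_0_compat; [lra | nra]).
  assert (0 <= (x * x + y * y) * (x * x + y * y)) by nra.
  assert (0 <= P * P + 2 * P * Q * (x * x - y * y)
          + Q * Q * ((x * x + y * y) * (x * x + y * y)) + (x * x + y * y)).
  { assert (0 <= (P * Q) * (x * x - y * y)) by (apply Rmult_le_pos; lra).
    assert (0 <= Q * Q * ((x * x + y * y) * (x * x + y * y))) by (apply Rmult_le_pos; nra).
    nra. }
  nra.
Qed.

(** This is [u / (1 + u) <= tanh u], since [tanh u = (1 - E) / (1 + E)] for [E = exp (-2u)]. The
    companion bound is [tanh u <= u / (1 - u)]. *)
Lemma exp_ratio_lower (u : R) : 0 < u ->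
  u * (1 + exp (- 2 * u)) <= (1 + u) * (1 - exp (- 2 * u)).
Proof.
  intros Hu.
  assert (H : exp (- 2 * u) * (1 + 2 * u) <= 1).
  { pose proof (exp_ineq1_le (2 * u)).
    assert (exp (- 2 * u) * exp (2 * u) = 1) by
      (rewrite <- exp_plus; replace (- 2 * u + 2 * u) with 0 by ring; apply exp_0).
    pose proof (exp_pos (- 2 * u)). nra. }
  nra.
Qed.

Lemma exp_ratio_upper (u : R) : 0 < u < 1 ->
  (1 - u) * (1 - exp (- 2 * u)) <= u * (1 + exp (- 2 * u)).
Proof. intros Hu. pose proof (exp_ineq1_le (- 2 * u)). nra. Qed.

(** The constraint reads [tanh u (|g|^2 + |S|^2) <= 2 Re (g conj S)]; replacing [tanh u] by its
    rational lower bound leaves a polynomial condition. The left factor below is [|g|^2 + |S|^2]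
    written out. *)
Lemma gap_real_necessary (u x y P Q : R) :
  0 < u -> 0 <= gap (exp (- 2 * u)) x y P 0 Q 0 ->
  u * (P * P + 2 * P * Q * (x * x - y * y)
       + Q * Q * ((x * x + y * y) * (x * x + y * y)) + (x * x + y * y))
  <= (1 + u) * (2 * x * (P + Q * (x * x + y * y))).
Proof.
  intros Hu Hg. rewrite gap_real in Hg.
  set (G := P * P + _ + _ + _) in *.
  assert (HG : 0 <= G).
  { unfold G.
    replace (P * P + 2 * P * Q * (x * x - y * y)
       + Q * Q * ((x * x + y * y) * (x * x + y * y)) + (x * x + y * y))
      with ((P + Q * (x * x - y * y)) * (P + Q * (x * x - y * y))
            + (2 * Q * x * y) * (2 * Q * x * y) + (x * x + y * y)) by ring.
    apply Rplus_le_le_0_compat; apply sum_sqr_nonneg. }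
  pose proof (exp_ratio_lower u Hu). pose proof (exp_pos (- 2 * u)).
  set (E := exp (- 2 * u)) in *. set (N := x * (P + _)) in *.
  replace (2 * x * (P + Q * (x * x + y * y))) with (2 * N) by (unfold N; ring).
  apply Rmult_le_reg_l with (1 + E); [lra|].
  assert (u * (1 + E) * G <= (1 + u) * (1 - E) * G) by (apply Rmult_le_compat_r; lra).
  assert ((1 + u) * ((1 - E) * G) <= (1 + u) * (2 * (1 + E) * N)) by
    (apply Rmult_le_compat_l; lra).
  nra.
Qed.

Lemma gap_real_sufficient (u x y P Q : R) :
  0 < u < 1 -> 
  u * (P * P + 2 * P * Q * (x * x - y * y)
       + Q * Q * ((x * x + y * y) * (x * x + y * y)) + (x * x + y * y))
  <= (1 - u) * (2 * x * (P + Q * (x * x + y * y))) ->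
  0 <= gap (exp (- 2 * u)) x y P 0 Q 0.
Proof.
  intros Hu Hg. rewrite gap_real.
  set (G := P * P + _ + _ + _) in *.
  assert (HG : 0 <= G).
  { unfold G.
    replace (P * P + 2 * P * Q * (x * x - y * y)
       + Q * Q * ((x * x + y * y) * (x * x + y * y)) + (x * x + y * y))
      with ((P + Q * (x * x - y * y)) * (P + Q * (x * x - y * y))
            + (2 * Q * x * y) * (2 * Q * x * y) + (x * x + y * y)) by ring.
    apply Rplus_le_le_0_compat; apply sum_sqr_nonneg. }
  pose proof (exp_ratio_upper u Hu). pose proof (exp_pos (- 2 * u)).
  set (E := exp (- 2 * u)) in *. set (N := x * (P + _)) in *.
  replace (2 * x * (P + Q * (x * x + y * y))) with (2 * N) in Hg by (unfold N; ring).
  apply Rmult_le_reg_l with (1 - u); [lra|].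
  assert ((1 - u) * (1 - E) * G <= u * (1 + E) * G) by (apply Rmult_le_compat_r; lra).
  assert ((1 + E) * (u * G) <= (1 + E) * ((1 - u) * (2 * N))) by
    (apply Rmult_le_compat_l; lra).
  nra.
Qed.

(** * Feasibility of the scaled pair *)

Lemma Rle_of_sqr_le (u v : R) : 0 <= v -> u * u <= v * v -> u <= v.
Proof. intros Hv H. destruct (Rle_lt_dec u v); [assumption | nra]. Qed.

(** [R0] stands for [|S|^2], and the three equations between [h], [P], [Q], [l] are the balance of
    the three minima. Depending on the size of [R0], one of the three terms in the sum dominates;
    its own minimum is [h], and the slack [eps] pays for the other two. *)
Lemma scaling_test_inequality (m h eps P Q l x R0 : R) :
  0 < m -> 0 < eps < 1 -> 0 < h -> h <= eps * eps / 64 ->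
  0 < P -> 0 < Q -> P * h = 2 * m -> 8 * (P * Q) = h * h -> Q * (h * h) = 4 * l ->
  m <= x -> 0 <= R0 -> R0 <= 2 * (x * x) ->
  0 < (1 - eps) * h - l * x ->
  ((1 - eps) * h - l * x) * (P * P + (Q * R0) * (Q * R0) + R0 * (1 + h * h / 4))
  <= (1 - h) * (2 * x * (P + Q * R0)).
Proof.
  intros Hm He Hh Hh1 HP HQ E1 E2 E3 Hx HR HR2 Hu.
  assert (Hh2 : h <= /64) by nra.
  assert (Hhe : h <= eps / 64) by nra.
  assert (Hl : 0 < l) by (assert (0 < Q * (h * h)) by (repeat apply Rmult_lt_0_compat; lra); lra).
  set (u := (1 - eps) * h - l * x) in *.
  assert (Hu1 : u <= (1 - eps) * h) by (unfold u; nra).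
  (* With this threshold the minor terms cost at most a factor [1 + eps/4] in the two outer ranges,
     while in the middle range [eps P] and [eps Q R0] are still at most [8x]. *)
  set (d := eps * eps / 16).
  assert (Hd : 0 < d <= eps / 16) by (unfold d; nra).
  assert (HPQ2 : (P * Q) * (P * Q) <= 1).
  { assert (P * Q <= 1) by nra. assert (0 < P * Q) by nra. nra. }
  assert (HQR : 0 <= Q * R0) by nra.
  assert (HR4 : R0 * (1 + h * h / 4) <= 2 * R0).
  { rewrite (Rmult_comm 2). apply Rmult_le_compat_l; nra. }
  (* Near range: [P] dominates, and the claim rests on [h P = 2m <= 2x]. *)
  destruct (Rle_lt_dec R0 (d * (P * P))) as [Ha | Ha].
  - assert (HG : P * P + Q * R0 * (Q * R0) + R0 * (1 + h * h / 4) <= P * P * (1 + eps / 4)).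
    { assert (Q * R0 <= d * ((P * Q) * P)) by nra.
      assert (Q * R0 * (Q * R0) <= d * ((P * Q) * P) * (d * ((P * Q) * P))) by
        (apply Rmult_le_compat; lra).
      assert (d * ((P * Q) * P) * (d * ((P * Q) * P)) <= d * d * (P * P)).
      { replace (d * ((P * Q) * P) * (d * ((P * Q) * P))) with
          (((P * Q) * (P * Q)) * (d * d * (P * P))) by ring.
        assert (0 <= d * d * (P * P)) by (apply Rmult_le_pos; nra). nra. }
      assert (d * d * (P * P) <= eps / 16 * (P * P)) by (apply Rmult_le_compat_r; nra).
      assert (2 * R0 <= eps / 8 * (P * P)) by nra.
      lra. }
    assert (HP2 : h * (P * P) <= 2 * x * P) by nra.
    assert (H1 : u * (P * P + Q * R0 * (Q * R0) + R0 * (1 + h * h / 4))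
            <= (1 - eps) * h * (P * P * (1 + eps / 4))).
    { eapply Rle_trans; [apply Rmult_le_compat_l; [lra | exact HG]|].
      apply Rmult_le_compat_r; nra. }
    assert (H2 : (1 - eps) * h * (P * P * (1 + eps / 4)) <= (1 - h) * (2 * x * P)).
    { replace ((1 - eps) * h * (P * P * (1 + eps / 4))) with
        (((1 - eps) * (1 + eps / 4)) * (h * (P * P))) by ring.
      apply Rmult_le_compat; nra. }
    assert (0 <= (1 - h) * (2 * x * (Q * R0))) by (repeat apply Rmult_le_pos; lra).
    lra.
  (* Far range: [Q R0] dominates, and the overlap term [l x] has to help. *)
  - destruct (Rle_lt_dec 1 (d * (Q * Q * R0))) as [Hc | Hc].
    + set (w := Q * R0) in *.
      assert (HG : P * P + w * w + R0 * (1 + h * h / 4) <= w * w * (1 + eps / 4)).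
      { assert (R0 <= d * (w * w)) by (unfold w; nra).
        assert (P * P <= d * d * (w * w)).
        { assert (P <= P * (d * (Q * Q * R0))) by nra.
          assert (P * (d * (Q * Q * R0)) = d * (P * Q) * w) by (unfold w; ring).
          assert (d * (P * Q) * w <= d * w) by (apply Rmult_le_compat_r; nra).
          assert (P <= d * w) by lra.
          replace (d * d * (w * w)) with ((d * w) * (d * w)) by ring.
          apply Rmult_le_compat; lra. }
          assert (0 <= w * w) by nra.
        assert (d * d <= d) by nra.
        nra. }
      (* [4 t (c - t) <= c^2] with [t = l x] and [c = (1 - eps) h], combined with [Q h^2 = 4l]. *)
      assert (HQux : Q * (u * x) <= (1 - eps) * (1 - eps)).
      { apply Rmult_le_reg_l with (h * h); [nra|].
        replace (h * h * (Q * (u * x))) with ((Q * (h * h)) * (u * x)) by ring.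
        rewrite E3. unfold u. pose proof (Rle_0_sqr ((1 - eps) * h - 2 * (l * x))).
        unfold Rsqr in *. nra. }
      assert (Huw : u * w * (1 + eps / 4) <= (1 - h) * (2 * x)).
      { assert (u * w <= 2 * x * ((1 - eps) * (1 - eps))).
        { assert (u * w <= u * (Q * (2 * (x * x)))) by
            (apply Rmult_le_compat_l; [lra | unfold w; apply Rmult_le_compat_l; lra]).
          nra. }
        assert (0 < 2 * x) by lra.
        assert ((1 - eps) * (1 - eps) * (1 + eps / 4) <= 1 - h) by nra.
        assert (u * w * (1 + eps / 4) <= 2 * x * ((1 - eps) * (1 - eps)) * (1 + eps / 4)) by
          (apply Rmult_le_compat_r; lra).
        assert (2 * x * ((1 - eps) * (1 - eps) * (1 + eps / 4)) <= 2 * x * (1 - h)) by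
          (apply Rmult_le_compat_l; lra).
        lra. }
      assert (u * (P * P + w * w + R0 * (1 + h * h / 4)) <= u * (w * w * (1 + eps / 4))) by
        (apply Rmult_le_compat_l; lra).
      assert (u * w * (1 + eps / 4) * w <= (1 - h) * (2 * x) * w) by
        (apply Rmult_le_compat_r; lra).
      assert (0 <= (1 - h) * (2 * x * P)) by (repeat apply Rmult_le_pos; lra).
      lra.
    + (* here AM-GM gives [h R <= 2x (P + Q R)] and the two other terms are of lower order *)
      set (w := Q * R0) in *.
      assert (Hep : eps * P <= 8 * x).
      { apply Rle_of_sqr_le; [lra|]. unfold d in Ha. nra. }
      assert (Hew : eps * w <= 8 * x).
      { apply Rle_of_sqr_le; [lra|].
        assert (d * (w * w) <= R0) by (unfold w; nra).
        unfold d in *. nra. }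
      assert (Hamgm : h * R0 <= 2 * x * (P + w)).
      { apply Rle_of_sqr_le; [apply Rmult_le_pos; lra|].
        assert (4 * (P * w) <= (P + w) * (P + w)) by
          (pose proof (Rle_0_sqr (P - w)); unfold Rsqr in *; nra).
        assert (4 * (P * w) = h * h * R0 / 2) by
          (unfold w; replace (4 * (P * (Q * R0))) with (8 * (P * Q) * R0 / 2) by field;
           rewrite E2; field).
        assert (h * h * R0 / 2 * (2 * R0) <= (P + w) * (P + w) * (4 * (x * x))) by
          (apply Rmult_le_compat; nra).
        nra. }
      assert (HP2 : h * (P * P) <= eps / 16 * (2 * x * P)).
      { assert (h * P <= eps / 8 * x) by nra. nra. }
      assert (Hw2 : h * (w * w) <= eps / 16 * (2 * x * w)).
      { assert (h * w <= eps / 8 * x) by nra. nra. }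
      assert (HN : 0 <= 2 * x * (P + w)) by (apply Rmult_le_pos; lra).
      assert (HG0 : 0 <= P * P + w * w + R0 * (1 + h * h / 4)) by nra.
      assert (u * (P * P + w * w + R0 * (1 + h * h / 4)) <=
              (1 - eps) * h * (P * P + w * w + R0 * (1 + h * h / 4))) by
        (apply Rmult_le_compat_r; lra).
      assert ((h * R0) * (1 + h * h / 4) <= 2 * x * (P + w) * (1 + h * h / 4)) by
        (apply Rmult_le_compat_r; nra).
      assert (Hs : h * (P * P + w * w + R0 * (1 + h * h / 4)) <=
              2 * x * (P + w) * (1 + h * h / 4 + eps / 16)) by nra.
      assert ((1 - eps) * (h * (P * P + w * w + R0 * (1 + h * h / 4))) <=
              (1 - eps) * (2 * x * (P + w) * (1 + h * h / 4 + eps / 16))) by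
        (apply Rmult_le_compat_l; lra).
      assert ((1 - eps) * (1 + h * h / 4 + eps / 16) <= 1 - h) by nra.
      assert (2 * x * (P + w) * ((1 - eps) * (1 + h * h / 4 + eps / 16)) <=
              2 * x * (P + w) * (1 - h)) by (apply Rmult_le_compat_l; lra).
      lra.
Qed.

Lemma scaling_test_feasible (Sset : R -> R -> Prop) (m h eps : R) :
  0 < m -> (forall x y, Sset x y -> m <= x /\ y * y <= x * x) ->
  0 < eps < 1 -> 0 < h -> h <= eps * eps / 64 ->
  feas Sset (h ^ 5 / (64 * m)) ((1 - eps) * h) (2 * m / h) 0 (h ^ 3 / (16 * m)) 0.
Proof.
  intros Hm HS He Hh Hh1 x y Hxy Hx.
  destruct (HS x y Hxy) as [Hmx Hyx].
  set (l := h ^ 5 / (64 * m)) in *. set (P := 2 * m / h). set (Q := h ^ 3 / (16 * m)).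
  assert (HP : 0 < P) by (unfold P; apply Rdiv_lt_0_compat; lra).
  assert (HQ : 0 < Q) by (unfold Q; apply Rdiv_lt_0_compat; [apply pow_lt; lra | lra]).
  assert (E2 : 8 * (P * Q) = h * h) by (unfold P, Q; field; lra).
  assert (Hl : 0 < l) by (unfold l; apply Rdiv_lt_0_compat; [apply pow_lt; lra | lra]).
  assert (Hlx : 0 < l * x) by (apply Rmult_lt_0_compat; lra).
  assert (Hh2 : h <= /64) by nra.
  apply gap_real_sufficient; [nra|].
  assert (Ht := scaling_test_inequality m h eps P Q l x (x * x + y * y) Hm He Hh Hh1 HP HQ
    ltac:(unfold P; field; lra) E2 ltac:(unfold Q, l; field; lra) Hmx
    ltac:(nra) ltac:(nra) ltac:(lra)).
  set (R0 := x * x + y * y) in *. set (u := (1 - eps) * h - l * x) in *.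
  assert (Hu : 0 < u <= h) by (unfold u; nra).
  assert (H0 : 0 <= 2 * x * (P + Q * R0)).
  { apply Rmult_le_pos; [lra|]. assert (0 <= Q * R0) by (apply Rmult_le_pos; unfold R0; nra). lra. }
  (* Since [2PQ = h^2/4], the cross term of [|g|^2] is absorbed by the factor [1 + h^2/4] of the
     test inequality. *)
  assert (2 * P * Q * (x * x - y * y) <= R0 * (h * h / 4)).
  { replace (2 * P * Q * (x * x - y * y)) with ((8 * (P * Q)) / 4 * (x * x - y * y)) by field.
    rewrite E2. rewrite (Rmult_comm R0). apply Rmult_le_compat_l; unfold R0; nra. }
  assert (u * (P * P + 2 * P * Q * (x * x - y * y) + Q * Q * (R0 * R0) + R0) <=
          u * (P * P + Q * R0 * (Q * R0) + R0 * (1 + h * h / 4))) by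
    (apply Rmult_le_compat_l; lra).
  assert ((1 - h) * (2 * x * (P + Q * R0)) <= (1 - u) * (2 * x * (P + Q * R0))) by
    (apply Rmult_le_compat_r; lra).
  lra.
Qed.

(** * Necessary conditions *)

(** With [t = Re S^2] and [R0 = |S|^2], the right-hand side is [|g|^2], and it differs from
    [(P + Q R0)^2] by [2PQ (t - R0)]. It serves as long as the signs of [P] and [Q] are unknown. *)
Lemma real_symbol_sqr_lower (P Q t R0 : R) :
  0 <= t <= R0 ->
  (P + Q * R0) * (P + Q * R0) <= P * P + 2 * P * Q * t + Q * Q * (R0 * R0) \/ 0 <= P * Q.
Proof.
  intros Ht. destruct (Rle_lt_dec 0 (P * Q)); [right; assumption | left].
  assert (P * Q * (R0 - t) <= 0) by nra. nra.
Qed.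

(** The points [m] and [X] are too far apart for a pair with a wrong sign or a wrong dominating
    term: each wrong case bounds [h^2 X] by a fixed multiple of [m], whereas [h^2 X = 32m/h^2]. The
    two last hypotheses are the constraints at these points with crude constants. *)
Lemma feasible_a_priori (m h P Q t1 R1 X t3 R3 : R) :
  0 < m -> 0 < h <= / 1000 -> X * (h * h * h * h) = 32 * m ->
  0 <= t1 <= R1 -> m * m <= R1 <= 2 * (m * m) ->
  0 <= t3 <= R3 -> X * X <= R3 <= 2 * (X * X) ->
  h * (P * P + 2 * P * Q * t1 + Q * Q * (R1 * R1) + R1) <= 8 * m * (P + Q * R1) ->
  h * (P * P + 2 * P * Q * t3 + Q * Q * (R3 * R3) + R3) <= 32 * X * (P + Q * R3) ->
  0 <= Q /\ h * m / 16 <= P /\ h * P <= 16 * m /\ Q * m <= 2 * (h * h * h).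
Proof.
  intros Hm Hh EX Ht1 HR1 Ht3 HR3 K1 K3.
  assert (Hh2 : 0 < h * h <= / 1000000) by nra.
  set (Y := h * h * X).
  assert (HY : Y * (h * h) = 32 * m) by (unfold Y; rewrite <- EX; ring).
  assert (HYpos : 0 < Y) by (apply Rmult_lt_reg_r with (h * h); lra).
  assert (HYb : 32000000 * m <= Y) by nra.
  assert (HX : 0 < X).
  { apply Rmult_lt_reg_l with (h * h); [lra|]. unfold Y in *; lra. }
  assert (HXY : Y <= X) by (unfold Y; nra).
  assert (HXm : 2 * m <= X) by lra.
  assert (Hmm : 0 < m * m) by nra.
  assert (HR13 : 2 * R1 <= R3) by nra.
  assert (L1 : h * m <= 8 * (P + Q * R1)).
  { assert (0 <= P * P + 2 * P * Q * t1 + Q * Q * (R1 * R1)).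
    { destruct (real_symbol_sqr_lower P Q t1 R1 Ht1) as [HH|HH];
        [pose proof (Rle_0_sqr (P + Q * R1)); unfold Rsqr in *; lra|].
      assert (0 <= P * Q * t1) by (apply Rmult_le_pos; lra).
      pose proof (Rle_0_sqr P); pose proof (Rle_0_sqr (Q * R1)); unfold Rsqr in *; nra. }
    assert (h * (m * m) <= 8 * m * (P + Q * R1)).
    { eapply Rle_trans; [|exact K1]. apply Rmult_le_compat_l; lra. }
    apply Rmult_le_reg_l with m; lra. }
  assert (L3 : h * X <= 32 * (P + Q * R3)).
  { assert (0 <= P * P + 2 * P * Q * t3 + Q * Q * (R3 * R3)).
    { destruct (real_symbol_sqr_lower P Q t3 R3 Ht3) as [HH|HH];
        [pose proof (Rle_0_sqr (P + Q * R3)); unfold Rsqr in *; lra|].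
      assert (0 <= P * Q * t3) by (apply Rmult_le_pos; lra).
      pose proof (Rle_0_sqr P); pose proof (Rle_0_sqr (Q * R3)); unfold Rsqr in *; nra. }
    assert (h * (X * X) <= 32 * X * (P + Q * R3)).
    { eapply Rle_trans; [|exact K3]. apply Rmult_le_compat_l; lra. }
    apply Rmult_le_reg_l with X; lra. }
  assert (HhX : 0 < h * X) by (apply Rmult_lt_0_compat; lra).
  assert (Hhm : 0 < h * m) by (apply Rmult_lt_0_compat; lra).
  assert (EY : h * (h * X) = Y) by (unfold Y; ring).
  (* If [Q < 0], positivity of [P + Q R3] and [2 R1 <= R3] keep [P + Q R1] above [P/2]; the near
     point then bounds [P] by [32m/h], too small for the far point. *)
  assert (HQ : 0 <= Q).
  { destruct (Rle_lt_dec 0 Q) as [HQ|HQ]; [exact HQ | exfalso].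
    assert (Q * R3 <= 2 * (Q * R1)) by nra.
    assert (Q * R1 <= 0) by nra.
    assert (HP : 0 < P) by lra.
    assert (HPh : P / 2 <= P + Q * R1) by lra.
    assert (P / 2 * (P / 2) <= (P + Q * R1) * (P + Q * R1)) by (apply Rmult_le_compat; lra).
    destruct (real_symbol_sqr_lower P Q t1 R1 Ht1) as [HH|HH]; [|nra].
    assert (h * (P / 2 * (P / 2)) <= 8 * m * P).
    { eapply Rle_trans; [|eapply Rle_trans; [exact K1|]].
      - apply Rmult_le_compat_l; lra.
      - apply Rmult_le_compat_l; lra. }
    assert (h * P <= 32 * m) by (apply Rmult_le_reg_r with P; lra).
    assert (h * X <= 32 * P) by lra.
    assert (h * (h * X) <= h * (32 * P)) by (apply Rmult_le_compat_l; lra).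
    lra. }
  assert (HQR : 0 <= Q * R1) by (apply Rmult_le_pos; lra).
  assert (HQR3 : 2 * (Q * R1) <= Q * R3) by nra.
  assert (HQX : Q * (X * X) <= Q * R3) by (apply Rmult_le_compat_l; lra).
  assert (Hdiv : forall B, 0 <= B -> h * (Q * R3 * (Q * R3)) <= B * X * (Q * R3) -> h * (Q * X) <= B).
  { intros B HB HH. destruct HQ as [HQ|HQ]; [|subst Q; lra].
    assert (0 < Q * R3) by (apply Rmult_lt_0_compat; nra).
    assert (h * (Q * R3) <= B * X) by (apply Rmult_le_reg_r with (Q * R3); lra).
    apply Rmult_le_reg_r with X; [exact HX|].
    assert (h * (Q * (X * X)) <= h * (Q * R3)) by (apply Rmult_le_compat_l; lra). lra. }
  assert (HP : 0 <= P).
  { destruct (Rle_lt_dec 0 P) as [HP|HP]; [exact HP | exfalso].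
    assert (Hg : Q * R3 / 2 * (Q * R3 / 2) <= (P + Q * R3) * (P + Q * R3)) by
      (apply Rmult_le_compat; lra).
    assert (0 < Q) by (destruct HQ as [HQ|HQ]; [exact HQ | subst Q; lra]).
    destruct (real_symbol_sqr_lower P Q t3 R3 Ht3) as [HH|HH]; [|nra].
    assert (h * (Q * X) <= 128).
    { apply Hdiv; [lra|].
      assert (h * (Q * R3 / 2 * (Q * R3 / 2)) <= 32 * X * (Q * R3)); [|lra].
      eapply Rle_trans; [|eapply Rle_trans; [exact K3|]].
      - apply Rmult_le_compat_l; lra.
      - apply Rmult_le_compat_l; lra. }
    assert (h * m <= 16 * (Q * m) * m) by nra.
    assert (h <= 16 * (Q * m)) by (apply Rmult_le_reg_r with m; lra).
    assert (h * (h * X) <= 16 * (Q * m) * (h * X)) by (apply Rmult_le_compat_r; lra).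
    assert (h * (Q * X) * m <= 128 * m) by (apply Rmult_le_compat_r; lra).
    lra. }
  assert (HPQ : 0 <= P * Q) by (apply Rmult_le_pos; lra).
  assert (G3 : h * (Q * R3 * (Q * R3)) <= 32 * X * (P + Q * R3)).
  { eapply Rle_trans; [|exact K3]. apply Rmult_le_compat_l; [lra|].
    assert (0 <= P * Q * t3) by (apply Rmult_le_pos; lra). nra. }
  assert (G1 : h * (P * P) <= 8 * m * (P + Q * R1)).
  { eapply Rle_trans; [|exact K1]. apply Rmult_le_compat_l; [lra|].
    assert (0 <= P * Q * t1) by (apply Rmult_le_pos; lra).
    pose proof (Rle_0_sqr (Q * R1)); unfold Rsqr in *; nra. }
  assert (HPR : Q * R1 < P).
  { destruct (Rlt_le_dec (Q * R1) P) as [HP1|HP1]; [exact HP1 | exfalso].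
    assert (h * (Q * X) <= 64).
    { apply Hdiv; [lra|]. eapply Rle_trans; [exact G3|].
      replace (64 * X * (Q * R3)) with (32 * X * (2 * (Q * R3))) by ring.
      apply Rmult_le_compat_l; lra. }
    assert (h * m <= 32 * (Q * m) * m) by nra.
    assert (h <= 32 * (Q * m)) by (apply Rmult_le_reg_r with m; lra).
    assert (h * (h * X) <= 32 * (Q * m) * (h * X)) by (apply Rmult_le_compat_r; lra).
    assert (h * (Q * X) * m <= 64 * m) by (apply Rmult_le_compat_r; lra).
    lra. }
  assert (HhP : h * P <= 16 * m).
  { apply Rmult_le_reg_r with P; [lra|].
    assert (8 * m * (P + Q * R1) <= 8 * m * (2 * P)) by (apply Rmult_le_compat_l; lra). lra. }
  split; [exact HQ|]. split; [lra|]. split; [exact HhP|].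
  assert (HQX64 : h * (Q * X) <= 64).
  { destruct (Rle_lt_dec P (Q * R3)) as [HP3|HP3].
    - apply Hdiv; [lra|]. eapply Rle_trans; [exact G3|].
      replace (64 * X * (Q * R3)) with (32 * X * (2 * (Q * R3))) by ring.
      apply Rmult_le_compat_l; lra.
    - assert (h * (Q * (X * X)) <= 16 * m).
      { eapply Rle_trans; [|exact HhP]. apply Rmult_le_compat_l; lra. }
      apply Rmult_le_reg_r with X; lra. }
  assert (h * (Q * X) * (h * h * h) <= 64 * (h * h * h)).
  { apply Rmult_le_compat_r; [|lra]. repeat apply Rmult_le_pos; lra. }
  assert (h * (Q * X) * (h * h * h) = Q * (32 * m)) by (rewrite <- EX; ring).
  lra.
Qed.

(** At [s = 0] the hypotheses become [e >= 1], [e p <= 1], [(2e - 1) q <= 1] (if [q >= 1]) and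
    [2e <= p + q]. The first three give [p <= 1] and [q <= 1], and the last then forces
    [e = p = q = 1]. The lemma is the version stable under errors of size [s]. *)
Lemma normalised_bounds (s e p q : R) :
  0 < s <= / 16 -> 1 - s <= e -> e <= 2 -> 0 <= p -> 0 <= q ->
  (e - s) * p <= 1 + s ->
  (1 <= q -> (e - /2) * (q * (2 - s)) <= 1 + s) ->
  (e - s) * (2 - s) <= (1 + s) * (p + q) ->
  Rabs (p - 1) <= 16 * s /\ Rabs (q - 1) <= 16 * s /\ Rabs (e - 1) <= 16 * s.
Proof.
  intros Hs He1 He2 Hp Hq H1 H3 H2.
  assert (Hp1 : p <= 1 + 4 * s).
  { destruct (Rle_lt_dec p (1 + 4 * s)); [assumption | exfalso].
    assert ((1 - 2 * s) * (1 + 4 * s) < (e - s) * p) by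
      (apply Rle_lt_trans with ((e - s) * (1 + 4 * s)); nra). nra. }
  assert (Hq1 : q <= 1 + 5 * s).
  { destruct (Rle_lt_dec q (1 + 5 * s)); [assumption | exfalso].
    assert (H := H3 ltac:(lra)).
    assert ((1 - 2 * s) / 2 * ((1 + 5 * s) * (2 - s)) <= (e - / 2) * (q * (2 - s))).
    { apply Rmult_le_compat; nra. }
    assert (1 + s < (1 - 2 * s) / 2 * ((1 + 5 * s) * (2 - s))); [|lra].
    assert ((1 - 2 * s) * (2 - s) >= 2 - 5 * s) by nra.
    replace ((1 - 2 * s) / 2 * ((1 + 5 * s) * (2 - s))) with
      ((1 - 2 * s) * (2 - s) * (1 + 5 * s) / 2) by field.
    nra. }
  assert (Hpq : 2 - 7 * s <= p + q).
  { destruct (Rle_lt_dec (2 - 7 * s) (p + q)); [assumption | exfalso].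
    assert ((1 - 2 * s) * (2 - s) <= (e - s) * (2 - s)) by nra. nra. }
  assert (He : e <= 1 + 16 * s).
  { destruct (Rle_lt_dec e (1 + 16 * s)); [assumption | exfalso].
    assert ((1 + 15 * s) * (2 - s) <= (e - s) * (2 - s)) by nra. nra. }
  repeat split; apply Rabs_le; lra.
Qed.

(** The cap [eta <= 2h] keeps the factors [1 + u] close to 1. The conditions on [h X0] and [h t0]
    put the last two test points in the far part of the region and make [t0] at most [s x^2] there,
    so that [|S|^2] is nearly [2 x^2]. *)
Lemma feasible_asymptotics_capped (Sset : R -> R -> Prop) (m y1 t0 X0 s h eta P Q : R) :
  0 < m -> Sset m y1 -> y1 * y1 <= m * m ->
  0 <= t0 -> 0 < X0 -> (forall x, X0 <= x -> t0 <= x * x /\ Sset x (sqrt (x * x - t0))) ->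
  0 < s <= / 16 -> 0 < h -> h <= s / 1000 -> h * X0 <= 4 * m -> h * t0 <= 16 * (m * m) * s ->
  (1 - s) * h <= eta <= 2 * h ->
  feas Sset (h ^ 5 / (64 * m)) eta P 0 Q 0 ->
  Rabs (P * h / (2 * m) - 1) <= 16 * s /\ Rabs (16 * m * Q / h ^ 3 - 1) <= 16 * s /\
  Rabs (eta / h - 1) <= 16 * s.
Proof.
  intros Hm HS1 Hy1 Ht0 HX0 HSx Hs Hh Hh1 HhX Hht Heta HF.
  (* Room for two losses of [1 + s/3] in each outer test: the factor [1 + u], and the neglect of the
     smaller of [P] and [Q R]. *)
  assert (Hs3 : (1 + s / 3) * (1 + s / 3) <= 1 + s) by nra.
  assert (Hsh : 0 < s * h <= h / 16) by nra.
  assert (Hmm : 0 < m * m) by nra.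
  assert (Hh3 : h <= / 16000) by lra.
  assert (Hhh : 0 < h * h <= h * / 16000) by (split; [nra | apply Rmult_le_compat_l; lra]).
  assert (Hh4 : 0 < h * h * (h * h) <= (h * / 16000) * (h * / 16000)) by
    (split; [nra | apply Rmult_le_compat; lra]).
  assert (Hhs : h * h <= s) by lra.
  assert (Hh4s : h * h * (h * h) <= s) by lra.
  assert (Hh4h : h * h * (h * h) <= h) by lra.
  set (x2 := 4 * m / (h * h)). set (x3 := 32 * m / (h * h * (h * h))).
  assert (Ex2 : x2 * (h * h) = 4 * m) by (unfold x2; field; lra).
  assert (Ex3 : x3 * (h * h * h * h) = 32 * m) by (unfold x3; field; lra).
  assert (Hx2 : 0 < x2) by (unfold x2; apply Rdiv_lt_0_compat; lra).
  assert (Hx3 : 0 < x3) by (unfold x3; apply Rdiv_lt_0_compat; lra).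
  assert (HX2 : X0 <= x2).
  { apply Rmult_le_reg_r with (h * h); [lra|]. rewrite Ex2. nra. }
  assert (Ex23 : x3 * (h * h) = 8 * x2) by (unfold x2, x3; field; lra).
  assert (Hx23 : x2 <= x3) by nra.
  assert (Ht2 : t0 <= s * (x2 * x2)).
  { apply Rmult_le_reg_r with (h * h * (h * h)); [lra|].
    replace (s * (x2 * x2) * (h * h * (h * h))) with (s * ((x2 * (h * h)) * (x2 * (h * h)))) by ring.
    rewrite Ex2. assert (t0 * (h * h * (h * h)) <= t0 * h) by (apply Rmult_le_compat_l; lra).
    lra. }
  assert (Hx22 : 0 < x2 * x2) by nra.
  assert (Hx33 : x2 * x2 <= x3 * x3) by (apply Rmult_le_compat; lra).
  assert (Hsx2 : s * (x2 * x2) <= /16 * (x2 * x2)) by (apply Rmult_le_compat_r; lra).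
  assert (Hsx3 : s * (x3 * x3) <= /16 * (x3 * x3)) by (apply Rmult_le_compat_r; lra).
  assert (Hsx23 : s * (x2 * x2) <= s * (x3 * x3)) by (apply Rmult_le_compat_l; lra).
  assert (Ht3 : t0 <= s * (x3 * x3)) by lra.
  destruct (HSx x2 HX2) as [_ HS2]. destruct (HSx x3 ltac:(lra)) as [_ HS3].
  set (l := h ^ 5 / (64 * m)) in *.
  (* The overlap term [l x] is at most [s h] at the first two points but equals [h/2] at the third,
     where it accounts for half of the leading exponent. *)
  assert (El1 : l * m = h * (h * h * (h * h)) / 64) by (unfold l; field; lra).
  assert (El2 : l * x2 = h * (h * h) / 16) by (unfold l, x2; field; lra).
  assert (El3 : l * x3 = h / 2) by (unfold l, x3; field; lra).
  assert (Hu1 : (1 - s) * h - s * h <= eta - l * m <= 2 * h).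
  { rewrite El1. assert (0 < h * (h * h * (h * h))) by (apply Rmult_lt_0_compat; lra).
    split; [|lra].
    assert (h * (h * h * (h * h)) <= h * s) by (apply Rmult_le_compat_l; lra). lra. }
  assert (Hu2 : eta - s * h <= eta - l * x2 <= 2 * h).
  { rewrite El2. assert (0 < h * (h * h)) by (apply Rmult_lt_0_compat; lra).
    split; [|lra].
    assert (h * (h * h) <= h * s) by (apply Rmult_le_compat_l; lra). lra. }
  assert (C1 := gap_real_necessary (eta - l * m) m y1 P Q ltac:(lra) (HF m y1 HS1 ltac:(lra))).
  assert (C2 := gap_real_necessary (eta - l * x2) _ _ P Q ltac:(lra) (HF _ _ HS2 ltac:(lra))).
  assert (C3 := gap_real_necessary (eta - l * x3) _ _ P Q ltac:(lra) (HF _ _ HS3 ltac:(lra))).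
  rewrite (sqrt_sqrt (x2 * x2 - t0)) in C2 by lra.
  rewrite (sqrt_sqrt (x3 * x3 - t0)) in C3 by lra.
  set (u1 := eta - l * m) in *. set (u2 := eta - l * x2) in *. set (u3 := eta - l * x3) in *.
  assert (Hu3 : h / 8 <= u3 <= 2 * h) by (unfold u3; lra).
  clear HF HSx HS1 HS2 HS3.
  set (R1 := m * m + y1 * y1) in *.
  replace (x2 * x2 - (x2 * x2 - t0)) with t0 in C2 by ring.
  replace (x3 * x3 - (x3 * x3 - t0)) with t0 in C3 by ring.
  set (R2 := x2 * x2 + (x2 * x2 - t0)) in *. set (R3 := x3 * x3 + (x3 * x3 - t0)) in *.
  set (t1 := m * m - y1 * y1) in *.
  assert (HR2 : (2 - s) * (x2 * x2) <= R2 <= 2 * (x2 * x2)) by (unfold R2; lra).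
  assert (HtR2 : 0 <= t0 <= R2) by (unfold R2; lra).
  assert (HR3 : (2 - s) * (x3 * x3) <= R3 <= 2 * (x3 * x3)) by (unfold R3; lra).
  assert (HR1 : m * m <= R1 <= 2 * (m * m)) by (unfold R1; pose proof (Rle_0_sqr y1); unfold Rsqr in *; lra).
  assert (Ht1 : 0 <= t1 <= R1) by (unfold t1, R1; pose proof (Rle_0_sqr y1); unfold Rsqr in *; lra).
  assert (Ht3R : 0 <= t0 <= R3) by (unfold R3; lra).
  assert (Hsq : forall t R0, 0 <= t <= R0 -> 0 <= P * P + 2 * P * Q * t + Q * Q * (R0 * R0)).
  { intros t R0 Ht. destruct (real_symbol_sqr_lower P Q t R0 Ht) as [HH|HH];
      [pose proof (Rle_0_sqr (P + Q * R0)); unfold Rsqr in *; lra|].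
    assert (0 <= P * Q * t) by (apply Rmult_le_pos; lra).
    pose proof (Rle_0_sqr P); pose proof (Rle_0_sqr (Q * R0)); unfold Rsqr in *; lra. }
  pose proof (Hsq t1 R1 Ht1) as G1. pose proof (Hsq t0 R3 Ht3R) as G3.
  assert (Hx3s : 0 < x3 * x3) by lra.
  assert (HN1 : 0 <= 2 * m * (P + Q * R1)).
  { apply Rmult_le_reg_l with (1 + u1); [lra|]. rewrite Rmult_0_r.
    eapply Rle_trans; [|exact C1]. apply Rmult_le_pos; lra. }
  assert (HN3 : 0 <= 2 * x3 * (P + Q * R3)).
  { apply Rmult_le_reg_l with (1 + u3); [lra|]. rewrite Rmult_0_r.
    eapply Rle_trans; [|exact C3]. apply Rmult_le_pos; lra. }
  assert (Hsq3 : x3 * x3 <= (2 - s) * (x3 * x3)) by lra.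
  destruct (feasible_a_priori m h P Q t1 R1 x3 t0 R3) as [HQ [HP [HhP HQm]]]; try lra.
  { assert (h / 2 * (P * P + 2 * P * Q * t1 + Q * Q * (R1 * R1) + R1) <=
            u1 * (P * P + 2 * P * Q * t1 + Q * Q * (R1 * R1) + R1)) by
      (apply Rmult_le_compat_r; lra).
    assert ((1 + u1) * (2 * m * (P + Q * R1)) <= 2 * (2 * m * (P + Q * R1))) by
      (apply Rmult_le_compat_r; lra).
    lra. }
  { assert (h / 8 * (P * P + 2 * P * Q * t0 + Q * Q * (R3 * R3) + R3) <=
            u3 * (P * P + 2 * P * Q * t0 + Q * Q * (R3 * R3) + R3)) by
      (apply Rmult_le_compat_r; lra).
    assert ((1 + u3) * (2 * x3 * (P + Q * R3)) <= 2 * (2 * x3 * (P + Q * R3))) by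
      (apply Rmult_le_compat_r; lra).
    lra. }
  assert (Hhm : 0 < h * m) by (apply Rmult_lt_0_compat; lra).
  assert (HPQ : 0 <= P * Q) by (apply Rmult_le_pos; lra).
  set (p := P * h / (2 * m)). set (q := 16 * m * Q / h ^ 3). set (e := eta / h).
  assert (EP : P * h = 2 * m * p) by (unfold p; field; lra).
  assert (EQ : 16 * m * Q = q * (h * (h * h))) by (unfold q; field; lra).
  assert (Ee : eta = e * h) by (unfold e; field; lra).
  assert (Hp0 : 0 <= p) by (unfold p; apply Rlt_le, Rdiv_lt_0_compat; [apply Rmult_lt_0_compat; lra | lra]).
  assert (Hq0 : 0 <= q).
  { unfold q. apply Rmult_le_pos; [apply Rmult_le_pos; lra|].
    apply Rlt_le, Rinv_0_lt_compat, pow_lt; lra. }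
  apply normalised_bounds; try lra.
  - apply Rmult_le_reg_r with h; lra.
  - apply Rmult_le_reg_r with h; lra.
  (* At [x = m] the a priori bounds make [Q R1] negligible against [P], and the constraint reduces
     to [u1 P <= 2m], that is [e p <= 1]. *)
  - assert (HQR1 : Q * R1 <= s / 3 * P).
    { assert (Q * R1 <= Q * (2 * (m * m))) by (apply Rmult_le_compat_l; lra).
      assert (Q * m * (2 * m) <= 2 * (h * h * h) * (2 * m)) by (apply Rmult_le_compat_r; lra).
      assert (4 * (h * h) * (h * m) <= s / 48 * (h * m)) by (apply Rmult_le_compat_r; lra).
      assert (s / 3 * (h * m / 16) <= s / 3 * P) by (apply Rmult_le_compat_l; lra).
      lra. }
    assert (D1 : u1 * (P * P) <= (1 + s / 3) * (2 * m * ((1 + s / 3) * P))).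
    { assert (0 <= P * Q * t1) by (apply Rmult_le_pos; lra).
      assert (u1 * (P * P) <= u1 * (P * P + 2 * P * Q * t1 + Q * Q * (R1 * R1) + R1)).
      { apply Rmult_le_compat_l; [lra|].
        pose proof (Rle_0_sqr (Q * R1)); unfold Rsqr in *; lra. }
      eapply Rle_trans; [eassumption|]. eapply Rle_trans; [exact C1|].
      apply Rmult_le_compat; [lra | lra | lra |]. apply Rmult_le_compat_l; lra. }
    assert (D1' : u1 * P <= 2 * m * (1 + s)).
    { apply Rmult_le_reg_r with P; [lra|].
            assert (2 * m * P * ((1 + s / 3) * (1 + s / 3)) <= 2 * m * P * (1 + s)) by
        (apply Rmult_le_compat_l; [apply Rmult_le_pos; lra | lra]).
      lra. }
    assert (Hu1e : (e - s) * h <= u1).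
    { unfold u1. rewrite El1, Ee.
      assert (h * (h * h * (h * h)) <= h * s) by (apply Rmult_le_compat_l; lra). lra. }
    assert ((e - s) * h * P <= u1 * P) by (apply Rmult_le_compat_r; lra).
    apply Rmult_le_reg_l with (2 * m); [lra|].
    replace (2 * m * ((e - s) * p)) with ((e - s) * (2 * m * p)) by ring.
    rewrite <- EP. lra.
  (* At [x3], [q >= 1] makes [P] negligible against [Q R3]. What remains is [u3 Q x3 <= 1] with
     [Q x3 = 2q/h] and [u3 = (e - 1/2) h]. *)
  - intros Hq1.
    assert (HQl : h * (h * h) <= 16 * m * Q) by (rewrite EQ; assert (0 < h * (h * h)) by (apply Rmult_lt_0_compat; lra);
      assert (1 * (h * (h * h)) <= q * (h * (h * h))) by (apply Rmult_le_compat_r; lra); lra).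
    assert (HQx : Q * x3 = 2 * q / h).
    { apply Rmult_eq_reg_r with (16 * m); [|lra].
      replace (Q * x3 * (16 * m)) with (16 * m * Q * x3) by ring. rewrite EQ.
      replace (2 * q / h * (16 * m)) with (q * (32 * m) / h) by (field; lra).
      rewrite <- Ex3. field; lra. }
    assert (HPQR : P <= s / 3 * (Q * R3)).
    { assert (Q * (x3 * x3) <= Q * R3) by (apply Rmult_le_compat_l; lra).
      assert (Hx3m : 64 * m * 64 <= s * (2 * x3)).
      { assert (H0 : s * (2 * x3) * (h * h * h * h) = s * (64 * m)) by
          (replace (s * (2 * x3) * (h * h * h * h)) with (2 * s * (x3 * (h * h * h * h))) by ring;
           rewrite Ex3; ring).
        apply Rmult_le_reg_r with (h * h * h * h); [lra|].
        rewrite H0.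
        assert (64 * (h * h * h * h) <= s) by lra.
        assert (64 * m * (64 * (h * h * h * h)) <= 64 * m * s) by (apply Rmult_le_compat_l; lra).
        lra. }
      assert (HQxh : 2 * x3 <= Q * (x3 * x3) * h).
      { replace (Q * (x3 * x3) * h) with (2 * q * x3) by
          (rewrite <- Rmult_assoc, HQx; field; lra).
        assert (1 * x3 <= q * x3) by (apply Rmult_le_compat_r; lra). lra. }
      apply Rmult_le_reg_l with h; [lra|].
      assert (s * (2 * x3) <= s * (Q * R3 * h)).
      { apply Rmult_le_compat_l; [lra|]. eapply Rle_trans; [exact HQxh|].
        apply Rmult_le_compat_r; lra. }
      lra. }
    assert (HQpos : 0 < Q).
    { apply Rmult_lt_reg_l with (16 * m); [lra|].
      assert (0 < h * (h * h)) by (apply Rmult_lt_0_compat; lra). lra. }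
    assert (HR3p : 0 < R3) by lra.
    assert (HQR3 : 0 < Q * R3) by (apply Rmult_lt_0_compat; lra).
    assert (D3 : u3 * (Q * R3 * (Q * R3)) <= (1 + s / 3) * (2 * x3 * ((1 + s / 3) * (Q * R3)))).
    { assert (0 <= P * Q * t0) by (apply Rmult_le_pos; lra).
      assert (u3 * (Q * R3 * (Q * R3)) <=
              u3 * (P * P + 2 * P * Q * t0 + Q * Q * (R3 * R3) + R3)).
      { apply Rmult_le_compat_l; [lra|].
        pose proof (Rle_0_sqr P); unfold Rsqr in *; lra. }
      eapply Rle_trans; [eassumption|]. eapply Rle_trans; [exact C3|].
      apply Rmult_le_compat; [lra | lra | lra |]. apply Rmult_le_compat_l; lra. }
    assert (D3' : u3 * (Q * R3) <= 2 * x3 * (1 + s)).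
    { apply Rmult_le_reg_r with (Q * R3); [lra|].
            assert (2 * x3 * (Q * R3) * ((1 + s / 3) * (1 + s / 3)) <= 2 * x3 * (Q * R3) * (1 + s)) by
        (apply Rmult_le_compat_l; [apply Rmult_le_pos; lra | lra]).
      lra. }
    assert (u3 * (Q * ((2 - s) * (x3 * x3))) <= u3 * (Q * R3)) by
      (apply Rmult_le_compat_l; [lra | apply Rmult_le_compat_l; lra]).
    assert (u3 * (Q * x3) * (2 - s) <= 2 * (1 + s)).
    { apply Rmult_le_reg_r with x3; [exact Hx3 | lra]. }
    rewrite HQx in *. assert (Eu3 : u3 = (e - /2) * h) by (unfold u3; rewrite El3, Ee; field).
    rewrite Eu3 in *.
    replace ((e - / 2) * h * (2 * q / h) * (2 - s)) with (2 * ((e - /2) * (q * (2 - s)))) in * by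
      (field; lra).
    lra.
  (* At [x2] only [|S|^2] is kept on the left. The two terms [P] and [2 Q x2^2] are [2mp/h] and
     [2mq/h], which gives [2e <= p + q]. *)
  - assert (D2 : u2 * R2 <= (1 + s) * (2 * x2 * (P + Q * (2 * (x2 * x2))))).
    { assert (u2 * R2 <= u2 * (P * P + 2 * P * Q * t0 + Q * Q * (R2 * R2) + R2)).
      { apply Rmult_le_compat_l; [lra|].
        assert (0 <= P * P + 2 * P * Q * t0 + Q * Q * (R2 * R2)); [|lra].
        apply Hsq. lra. }
      eapply Rle_trans; [eassumption|]. eapply Rle_trans; [exact C2|].
      assert (0 <= Q * R2) by (apply Rmult_le_pos; lra).
      apply Rmult_le_compat; [lra | apply Rmult_le_pos; lra | lra |].
      apply Rmult_le_compat_l; [lra|]. apply Rplus_le_compat_l, Rmult_le_compat_l; lra. }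
    assert (u2 * ((2 - s) * (x2 * x2)) <= u2 * R2) by (apply Rmult_le_compat_l; lra).
    assert (D2' : u2 * ((2 - s) * x2) <= (1 + s) * (2 * (P + Q * (2 * (x2 * x2))))).
    { apply Rmult_le_reg_r with x2; [exact Hx2 | lra]. }
    assert (EP2 : P = 2 * m * p / h) by (rewrite <- EP; field; lra).
    assert (EQ2 : Q * (2 * (x2 * x2)) = 2 * m * q / h).
    { apply Rmult_eq_reg_r with (16 * m); [|lra].
      replace (Q * (2 * (x2 * x2)) * (16 * m)) with (16 * m * Q * (2 * (x2 * x2))) by ring.
      rewrite EQ. unfold x2. field; lra. }
    rewrite EQ2, EP2 in D2'.
    assert (Hue : (e - s) * h <= u2) by lra.
    assert ((e - s) * h * ((2 - s) * x2) <= u2 * ((2 - s) * x2)) by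
      (apply Rmult_le_compat_r; [apply Rmult_le_pos; lra | exact Hue]).
    apply Rmult_le_reg_r with (4 * m / h); [apply Rdiv_lt_0_compat; lra|].
    replace ((e - s) * (2 - s) * (4 * m / h)) with ((e - s) * h * ((2 - s) * x2)) by
      (unfold x2; field; lra).
    replace ((1 + s) * (p + q) * (4 * m / h)) with
      ((1 + s) * (2 * (2 * m * p / h + 2 * m * q / h))) by (field; lra).
    lra.
Qed.

(** * Existence of an optimum *)

(* The properties of the set of values [S = x + iy] of the symbol's square root
   on which the analysis depends. *)
Record symbol_region (Sset : R -> R -> Prop) (m t0 X0 : R) : Prop := {
  sr_pos : 0 < m;
  sr_bounds : forall x y, Sset x y -> m <= x /\ y * y <= x * x;
  sr_min : exists y, Sset m y;
  sr_t0 : 0 <= t0;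
  sr_X0 : 0 < X0;
  sr_far : forall x, X0 <= x -> t0 < x * x /\ Sset x (sqrt (x * x - t0));
  sr_conj : forall x y, Sset x y -> Sset x (- y);
  sr_closed : forall (u v : nat -> R) (x y : R), (forall n, Sset (u n) (v n)) ->
    is_lim_seq u x -> is_lim_seq v y -> Sset x y }.

(** The real part of the pair is feasible, so the capped version applies. An [eta] above [2h] could
    be lowered to [2h] by monotonicity, but the capped version puts that value within [eps < 1] of
    [h] in relative terms, which is absurd. *)
Lemma feasible_asymptotics (Sset : R -> R -> Prop) (m t0 X0 eps : R) :
  symbol_region Sset m t0 X0 -> 0 < eps < 1 ->
  exists h0, 0 < h0 /\ forall h eta P1 P2 Q1 Q2, 0 < h <= h0 -> (1 - eps / 16) * h <= eta ->
    feas Sset (h ^ 5 / (64 * m)) eta P1 P2 Q1 Q2 ->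
    Rabs (P1 * h / (2 * m) - 1) <= eps /\ Rabs (16 * m * Q1 / h ^ 3 - 1) <= eps /\
    Rabs (eta / h - 1) <= eps.
Proof.
  intros HS He. destruct HS as [Hm Hb [y1 Hmin] Ht0 HX0 Hfar Hconj _].
  set (s := eps / 16).
  set (h0 := Rmin (s / 1000) (Rmin (4 * m / X0) (16 * (m * m) * s / (t0 + 1)))).
  exists h0. split.
  { unfold h0. repeat apply Rmin_pos; try apply Rdiv_lt_0_compat; try lra; unfold s; try lra.
    repeat apply Rmult_lt_0_compat; lra. }
  intros h eta P1 P2 Q1 Q2 Hh Heta HF.
  apply (feas_real_part _ _ _ _ _ _ _ Hconj) in HF.
  assert (H1 : h <= s / 1000) by (eapply Rle_trans; [apply Hh | apply Rmin_l]).
  assert (H2 : h <= 4 * m / X0).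
  { eapply Rle_trans; [apply Hh|]. eapply Rle_trans; [apply Rmin_r | apply Rmin_l]. }
  assert (H3 : h <= 16 * (m * m) * s / (t0 + 1)).
  { eapply Rle_trans; [apply Hh|]. eapply Rle_trans; [apply Rmin_r | apply Rmin_r]. }
  assert (H2' : h * X0 <= 4 * m).
  { apply Rmult_le_compat_r with (r := X0) in H2; [|lra].
    replace (4 * m / X0 * X0) with (4 * m) in H2 by (field; lra). exact H2. }
  assert (H3' : h * t0 <= 16 * (m * m) * s).
  { apply Rmult_le_compat_r with (r := t0 + 1) in H3; [|lra].
    replace (16 * (m * m) * s / (t0 + 1) * (t0 + 1)) with (16 * (m * m) * s) in H3 by
      (field; lra). lra. }
  assert (Hfar' : forall x, X0 <= x -> t0 <= x * x /\ Sset x (sqrt (x * x - t0))).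
  { intros x Hx. destruct (Hfar x Hx); split; [lra | assumption]. }
  assert (Hcap := fun eta' => feasible_asymptotics_capped Sset m y1 t0 X0 s h eta' P1 Q1 Hm Hmin
    (proj2 (Hb _ _ Hmin)) Ht0 HX0 Hfar' ltac:(unfold s; lra) ltac:(lra) H1 H2' H3').
  replace (16 * s) with eps in Hcap by (unfold s; field).
  destruct (Rle_lt_dec eta (2 * h)) as [Hle|Hgt].
  - apply Hcap; [lra | exact HF].
  - exfalso. destruct (Hcap (2 * h)) as [_ [_ H]].
    + assert (0 < s) by (unfold s; lra). nra.
    + apply feas_mono with eta; [lra | exact HF].
    + replace (2 * h / h - 1) with 1 in H by (field; lra). rewrite Rabs_R1 in H. lra.
Qed.

(** The constraint puts [g] in a disk centred at [c S] with [c = (1 + E)/(1 - E)] and radius at most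
    [c |S|]. Lowering [eta] to [eta1] enlarges the disk, so the bound is uniform in [eta]. *)
Lemma feas_coefficient_bound (l eta eta1 x y P1 P2 Q1 Q2 : R) :
  0 < x -> y * y <= x * x -> l * x < eta1 -> eta1 <= eta ->
  0 <= gap (exp (- 2 * (eta - l * x))) x y P1 P2 Q1 Q2 ->
  Rabs (gre x y P1 Q1 Q2) <= 6 * x / (1 - exp (- 2 * (eta1 - l * x))) /\
  Rabs (gim x y P2 Q1 Q2) <= 6 * x / (1 - exp (- 2 * (eta1 - l * x))).
Proof.
  intros Hx Hy Hl He Hg.
  assert (Hg1 : 0 <= gap (exp (- 2 * (eta1 - l * x))) x y P1 P2 Q1 Q2).
  { eapply Rle_trans; [exact Hg|]. apply gap_mono.
    destruct (Req_dec eta eta1) as [->|Hne]; [lra|]. left; apply exp_increasing; lra. }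
  rewrite gap_expand in Hg1. clear Hg.
  pose proof (exp_neg_lt_1 (eta1 - l * x) ltac:(lra)) as HE1.
  pose proof (exp_pos (- 2 * (eta1 - l * x))) as HE0.
  set (E := exp (- 2 * (eta1 - l * x))) in *.
  set (a := gre _ _ _ _ _) in *. set (b := gim _ _ _ _ _) in *. clearbody a b E.
  set (k := 1 - E) in *. assert (Hk : 0 < k <= 1) by (unfold k; lra).
  replace (1 + E) with (2 - k) in Hg1 by (unfold k; ring). clearbody k.
  set (c := (2 - k) / k).
  assert (Hc : 0 <= c <= 2 / k).
  { unfold c. split; [apply Rmult_le_pos; [lra | apply Rlt_le, Rinv_0_lt_compat; lra]|].
    apply Rmult_le_compat_r; [apply Rlt_le, Rinv_0_lt_compat; lra | lra]. }
  assert (Hd : (a - c * x) * (a - c * x) + (b - c * y) * (b - c * y) <= c * c * (x * x + y * y)).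
  { apply Rmult_le_reg_l with k; [lra|].
    assert (Ekc : k * c = 2 - k) by (unfold c; field; lra).
    assert (Hxy := sum_sqr_nonneg x y).
    assert (0 <= k * (x * x + y * y)) by (apply Rmult_le_pos; lra).
    replace (k * ((a - c * x) * (a - c * x) + (b - c * y) * (b - c * y))) with
      (k * (a * a + b * b) - 2 * (k * c) * (a * x + b * y) + k * (c * c * (x * x + y * y))) by ring.
    rewrite Ekc. lra. }
  assert (Hcx : 0 <= c * x) by (apply Rmult_le_pos; lra).
  assert (Hcc : 0 <= c * c) by nra.
  assert (c * c * (x * x + y * y) <= (2 * (c * x)) * (2 * (c * x))).
  { replace (2 * (c * x) * (2 * (c * x))) with (c * c * (4 * (x * x))) by ring.
    apply Rmult_le_compat_l; [exact Hcc | nra]. }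
  assert (Hya : Rabs y <= x) by (apply Rabs_le; split; nra).
  assert (Hcy : Rabs (c * y) <= c * x).
  { rewrite Rabs_mult, (Rabs_pos_eq c) by lra. apply Rmult_le_compat_l; lra. }
  assert (H6 : 3 * (c * x) <= 6 * x / k).
  { replace (6 * x / k) with (3 * (2 / k * x)) by (field; lra).
    apply Rmult_le_compat_l; [lra|]. apply Rmult_le_compat_r; lra. }
  assert (Ha2 : Rabs (a - c * x) <= 2 * (c * x)).
  { apply Rle_of_sqr_le; [lra|]. rewrite <- Rabs_mult, Rabs_pos_eq by apply Rle_0_sqr.
    pose proof (Rle_0_sqr (b - c * y)); unfold Rsqr in *; lra. }
  assert (Hb2 : Rabs (b - c * y) <= 2 * (c * x)).
  { apply Rle_of_sqr_le; [lra|]. rewrite <- Rabs_mult, Rabs_pos_eq by apply Rle_0_sqr.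
    pose proof (Rle_0_sqr (a - c * x)); unfold Rsqr in *; lra. }
  apply Rabs_le_between in Ha2. apply Rabs_le_between in Hb2. apply Rabs_le_between in Hcy.
  split; apply Rabs_le; lra.
Qed.

(** [g(S) - g(conj S) = 4 i x y Q]: the constraints at a non-real point and at its conjugate bound
    [Q], and then [P]. *)
Lemma feas_bounded (Sset : R -> R -> Prop) (l eta1 x y : R) :
  Sset x y -> Sset x (- y) -> 0 < x -> 0 < y -> y * y <= x * x -> l * x < eta1 ->
  exists B, forall eta P1 P2 Q1 Q2, eta1 <= eta -> feas Sset l eta P1 P2 Q1 Q2 ->
    Rabs P1 <= B /\ Rabs P2 <= B /\ Rabs Q1 <= B /\ Rabs Q2 <= B.
Proof.
  intros HS HS' Hx Hy Hyx Hl.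
  set (K := 6 * x / (1 - exp (- 2 * (eta1 - l * x)))).
  assert (HK : 0 < K).
  { unfold K. apply Rdiv_lt_0_compat; [lra|].
    pose proof (exp_neg_lt_1 (eta1 - l * x) ltac:(lra)); lra. }
  assert (Hxy : 0 < 2 * (x * y)) by nra.
  set (D := K / (2 * (x * y))).
  assert (HD : D * (2 * (x * y)) = K) by (unfold D; field; lra).
  assert (HDp : 0 < D) by (unfold D; apply Rdiv_lt_0_compat; lra).
  assert (Hxx : 0 < x * x) by nra.
  assert (HDx : 0 < D * (x * x)) by (apply Rmult_lt_0_compat; lra).
  exists (K + D + D * (x * x)). intros eta P1 P2 Q1 Q2 He HF.
  destruct (feas_coefficient_bound l eta eta1 x y P1 P2 Q1 Q2 Hx Hyx Hl He
    (HF x y HS ltac:(lra))) as [A1 A2].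
  destruct (feas_coefficient_bound l eta eta1 x (- y) P1 P2 Q1 Q2 Hx ltac:(nra) Hl He
    (HF x (- y) HS' ltac:(lra))) as [A3 A4].
  fold K in A1, A2, A3, A4. unfold gre in A1, A3. unfold gim in A2, A4.
  replace (- y * - y) with (y * y) in A3, A4 by ring.
  replace (2 * (x * - y)) with (- (2 * (x * y))) in A3, A4 by ring.
  set (b := 2 * (x * y)) in *. set (a := x * x - y * y) in *.
  assert (Ha : 0 <= a <= x * x) by (unfold a; nra).
  apply Rabs_le_between in A1. apply Rabs_le_between in A2.
  apply Rabs_le_between in A3. apply Rabs_le_between in A4.
  assert (Hdiv : forall q, - K <= q * b <= K -> - D <= q <= D).
  { intros q Hq. split; apply Rmult_le_reg_r with b; lra. }
  assert (HQ1 : - D <= Q1 <= D) by (apply Hdiv; lra).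
  assert (HQ2 : - D <= Q2 <= D) by (apply Hdiv; lra).
  assert (Hmul : forall q, - D <= q <= D -> - (D * (x * x)) <= q * a <= D * (x * x)).
  { intros q Hq. assert (D * a <= D * (x * x)) by (apply Rmult_le_compat_l; lra).
    assert (q * a <= D * a) by (apply Rmult_le_compat_r; lra).
    assert (- D * a <= q * a) by (apply Rmult_le_compat_r; lra). lra. }
  pose proof (Hmul Q1 HQ1). pose proof (Hmul Q2 HQ2).
  repeat split; apply Rabs_le; lra.
Qed.

Lemma optimal_eta_exists (Sset : R -> R -> Prop) (l eta1 B : R) :
  (exists P1 P2 Q1 Q2, feas Sset l eta1 P1 P2 Q1 Q2) ->
  (exists x y, Sset x y /\ Sset x (- y) /\ 0 < x /\ 0 < y /\ y * y <= x * x /\ l * x < eta1) ->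
  (forall eta P1 P2 Q1 Q2, eta1 <= eta -> feas Sset l eta P1 P2 Q1 Q2 -> eta <= B) ->
  exists eta, eta1 <= eta /\ (exists P1 P2 Q1 Q2, feas Sset l eta P1 P2 Q1 Q2) /\
    (forall eta' P1 P2 Q1 Q2, eta < eta' -> ~ feas Sset l eta' P1 P2 Q1 Q2).
Proof.
  intros Hne [x0 [y0 [HS [HS' [Hx0 [Hy0 [Hyx Hl]]]]]]] Hub.
  set (F := fun eta => eta1 <= eta /\ exists P1 P2 Q1 Q2, feas Sset l eta P1 P2 Q1 Q2).
  destruct (completeness F) as [eta [Hup Hlub]].
  { exists B. intros eta [H [P1 [P2 [Q1 [Q2 HF]]]]]. eapply Hub; eauto. }
  { exists eta1. split; [lra | exact Hne]. }
  assert (He1 : eta1 <= eta) by (apply Hup; split; [lra | exact Hne]).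
  exists eta. split; [exact He1|]. split.
  2:{ intros eta' P1 P2 Q1 Q2 Hlt HF. assert (eta' <= eta); [|lra].
      apply Hup. split; [lra | eauto 6]. }
  assert (Hseq : forall n : nat, exists z : R * R * R * R * R,
    let '(e, P1, P2, Q1, Q2) := z in
    eta - / (INR n + 1) < e /\ eta1 <= e /\ feas Sset l e P1 P2 Q1 Q2).
  { intros n. assert (Hn : 0 < / (INR n + 1)) by
      (apply Rinv_0_lt_compat; pose proof (pos_INR n); lra).
    destruct (Classical_Prop.classic (exists e, F e /\ eta - / (INR n + 1) < e)) as [[e [[H1 [P1 [P2 [Q1 [Q2 HF]]]]] H2]]|Hno].
    - exists (e, P1, P2, Q1, Q2). auto.
    - exfalso. assert (eta <= eta - / (INR n + 1)); [|lra].
      apply Hlub. intros e He. destruct (Rle_lt_dec e (eta - / (INR n + 1))); [assumption|].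
      exfalso; apply Hno; exists e; auto. }
  set (z := fun n => proj1_sig (constructive_indefinite_description _ (Hseq n))).
  assert (Hz : forall n, let '(e, P1, P2, Q1, Q2) := z n in
    eta - / (INR n + 1) < e /\ eta1 <= e /\ feas Sset l e P1 P2 Q1 Q2).
  { intros n. unfold z. destruct constructive_indefinite_description; assumption. }
  clearbody z.
  destruct (feas_bounded Sset l eta1 x0 y0 HS HS' Hx0 Hy0 Hyx Hl) as [C HC].
  set (ze := fun n => fst (fst (fst (fst (z n))))).
  set (zP1 := fun n => snd (fst (fst (fst (z n))))).
  set (zP2 := fun n => snd (fst (fst (z n)))).
  set (zQ1 := fun n => snd (fst (z n))). set (zQ2 := fun n => snd (z n)).
  assert (Hz' : forall n, eta - / (INR n + 1) < ze n /\ eta1 <= ze n /\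
    feas Sset l (ze n) (zP1 n) (zP2 n) (zQ1 n) (zQ2 n)).
  { intros n. specialize (Hz n). unfold ze, zP1, zP2, zQ1, zQ2.
    destruct (z n) as [[[[? ?] ?] ?] ?]; exact Hz. }
  assert (HB : forall n, Rabs (zP1 n) <= C /\ Rabs (zP2 n) <= C /\ Rabs (zQ1 n) <= C /\ Rabs (zQ2 n) <= C).
  { intros n. destruct (Hz' n) as [_ [H1 H2]]. eapply HC; eauto. }
  clearbody ze zP1 zP2 zQ1 zQ2. clear Hz z.
  destruct (bounded_subsequence2 zP1 zP2 C (fun n => proj1 (HB n)) (fun n => proj1 (proj2 (HB n))))
    as [f [P1 [P2 [Hf [L1 L2]]]]].
  destruct (bounded_subsequence2 (fun n => zQ1 (f n)) (fun n => zQ2 (f n)) C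
    (fun n => proj1 (proj2 (proj2 (HB (f n))))) (fun n => proj2 (proj2 (proj2 (HB (f n))))))
    as [g [Q1 [Q2 [Hg [L3 L4]]]]].
  apply (is_lim_seq_subseq _ _ g Hg) in L1. apply (is_lim_seq_subseq _ _ g Hg) in L2.
  assert (Hfg : filterlim (fun n => f (g n)) eventually eventually) by
    (eapply filterlim_comp; eauto).
  exists P1, P2, Q1, Q2. intros x y Hxy Hx.
  (* The exponents [ze] are replaced by their lower bounds [eta - 1/(n+1)], whose limit is known;
     [feas_mono] allows this. *)
  assert (Le : is_lim_seq (fun n => eta - / (INR (f (g n)) + 1)) eta).
  { replace (Finite eta) with (Finite (eta - 0)) by (f_equal; ring).
    apply is_lim_seq_minus'; [apply is_lim_seq_const|].
    exact (is_lim_seq_subseq _ _ _ Hfg is_lim_seq_inv_succ). }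
  apply is_lim_seq_nonneg with (u := fun n =>
    gap (exp (- 2 * (eta - / (INR (f (g n)) + 1) - l * x))) x y
      (zP1 (f (g n))) (zP2 (f (g n))) (zQ1 (f (g n))) (zQ2 (f (g n)))).
  - assert (Lx : is_lim_seq (fun n => l * x - (eta - / (INR (f (g n)) + 1))) (l * x - eta)) by
      (apply is_lim_seq_minus'; [apply is_lim_seq_const | exact Le]).
    destruct (is_lim_seq_eventually_lt _ _ 0 Lx ltac:(lra)) as [N HN].
    exists N. intros n Hn. specialize (HN n Hn).
    destruct (Hz' (f (g n))) as [H1 [H2 H3]].
    apply (feas_mono Sset l (ze (f (g n))) (eta - / (INR (f (g n)) + 1)) _ _ _ _ ltac:(lra) H3 x y Hxy).
    lra.
  - unfold gap, gre, gim. lim.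
Qed.

(** * Uniqueness of the optimum *)

(* [Z_n = (1 - 1/n) M + Z'/n] is tested at [eta + 1/n^2]: where the constraint at [M] is
   active, the gain [1/n] from [Z'] beats the loss [1/n^2] from the larger [eta]. *)
Lemma feas_improve (Sset : R -> R -> Prop) (l eta P1 P2 Q1 Q2 P1' P2' Q1' Q2' : R) :
  0 < l ->
  (forall x y, Sset x y -> 0 < x /\ y * y <= x * x) ->
  (forall (u v : nat -> R) (x y : R), (forall n, Sset (u n) (v n)) ->
    is_lim_seq u x -> is_lim_seq v y -> Sset x y) ->
  feas Sset l eta P1 P2 Q1 Q2 ->
  (forall x y, Sset x y -> l * x <= eta ->
     gap (exp (- 2 * (eta - l * x))) x y P1 P2 Q1 Q2 <= 0 ->
     l * x < eta /\ 0 < gap (exp (- 2 * (eta - l * x))) x y P1' P2' Q1' Q2') ->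
  exists eta' A1 A2 B1 B2, eta < eta' /\ feas Sset l eta' A1 A2 B1 B2.
Proof.
  intros Hl Hb Hcl HF Hact.
  apply Classical_Prop.NNPP. intros Hno.
  set (s := fun n : nat => / (INR n + 1)).
  assert (Hs : forall n, 0 < s n <= 1).
  { intros n. unfold s. pose proof (pos_INR n). split; [apply Rinv_0_lt_compat; lra|].
    rewrite <- Rinv_1. apply Rinv_le_contravar; lra. }
  assert (Hseq : forall n : nat, exists z : R * R,
    Sset (fst z) (snd z) /\ l * fst z < eta + s n * s n /\
    gap (exp (- 2 * (eta + s n * s n - l * fst z))) (fst z) (snd z)
      ((1 - s n) * P1 + s n * P1') ((1 - s n) * P2 + s n * P2')
      ((1 - s n) * Q1 + s n * Q1') ((1 - s n) * Q2 + s n * Q2') < 0).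
  { intros n. apply Classical_Prop.NNPP. intros Hn. apply Hno.
    do 5 eexists. split; [|intros x y Hxy Hx; apply Rnot_lt_le; intros Hg].
    2:{ apply Hn. exists (x, y). simpl. split; [exact Hxy|]. split; [exact Hx | exact Hg]. }
    specialize (Hs n). assert (0 < s n * s n) by nra. lra. }
  set (z := fun n => proj1_sig (constructive_indefinite_description _ (Hseq n))).
  set (zx := fun n => fst (z n)). set (zy := fun n => snd (z n)).
  assert (Hz : forall n, Sset (zx n) (zy n) /\ l * zx n < eta + s n * s n /\
    gap (exp (- 2 * (eta + s n * s n - l * zx n))) (zx n) (zy n)
      ((1 - s n) * P1 + s n * P1') ((1 - s n) * P2 + s n * P2')
      ((1 - s n) * Q1 + s n * Q1') ((1 - s n) * Q2 + s n * Q2') < 0).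
  { intros n. unfold zx, zy, z. destruct constructive_indefinite_description; assumption. }
  clearbody zx zy. clear z Hseq Hno.
  (* Since [l > 0], violated constraints stay in a bounded set and accumulate at a point [(X, Y)],
     where the constraint on the pair to be improved has no slack. *)
  assert (HBx : forall n, Rabs (zx n) <= (eta + 1) / l).
  { intros n. destruct (Hz n) as [H1 [H2 _]]. destruct (Hb _ _ H1) as [H3 _].
    rewrite Rabs_pos_eq by lra. apply Rmult_le_reg_l with l; [lra|].
    replace (l * ((eta + 1) / l)) with (eta + 1) by (field; lra).
    specialize (Hs n). nra. }
  assert (HBy : forall n, Rabs (zy n) <= (eta + 1) / l).
  { intros n. eapply Rle_trans; [|apply (HBx n)]. destruct (Hz n) as [H1 _].
    destruct (Hb _ _ H1) as [H3 H4]. rewrite (Rabs_pos_eq (zx n)) by lra.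
    apply Rabs_le; split; nra. }
  destruct (bounded_subsequence2 zx zy _ HBx HBy) as [f [X [Y [Hf [LX LY]]]]].
  assert (Ls : is_lim_seq (fun n => s (f n)) 0) by
    exact (is_lim_seq_subseq _ _ _ Hf is_lim_seq_inv_succ).
  assert (HSXY : Sset X Y).
  { apply (Hcl (fun n => zx (f n)) (fun n => zy (f n))); auto. intros n; apply Hz. }
  assert (HlX : l * X <= eta).
  { assert (0 <= eta + 0 * 0 - l * X); [|lra].
    apply is_lim_seq_nonneg with (u := fun n => eta + s (f n) * s (f n) - l * zx (f n)).
    - exists O. intros n _. destruct (Hz (f n)) as [_ [H _]]. lra.
    - lim. }
  assert (HgM : gap (exp (- 2 * (eta - l * X))) X Y P1 P2 Q1 Q2 <= 0).
  { assert (0 <= 0 - gap (exp (- 2 * (eta + 0 * 0 - l * X))) X Y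
      ((1 - 0) * P1 + 0 * P1') ((1 - 0) * P2 + 0 * P2')
      ((1 - 0) * Q1 + 0 * Q1') ((1 - 0) * Q2 + 0 * Q2')) as HH.
    { apply is_lim_seq_nonneg with (u := fun n => 0 -
        gap (exp (- 2 * (eta + s (f n) * s (f n) - l * zx (f n)))) (zx (f n)) (zy (f n))
        ((1 - s (f n)) * P1 + s (f n) * P1') ((1 - s (f n)) * P2 + s (f n) * P2')
        ((1 - s (f n)) * Q1 + s (f n) * Q1') ((1 - s (f n)) * Q2 + s (f n) * Q2')).
      - exists O. intros n _. destruct (Hz (f n)) as [_ [_ H]]. lra.
      - unfold gap, gre, gim. lim. }
    replace (eta + 0 * 0 - l * X) with (eta - l * X) in HH by ring.
    replace ((1 - 0) * P1 + 0 * P1') with P1 in HH by ring.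
    replace ((1 - 0) * P2 + 0 * P2') with P2 in HH by ring.
    replace ((1 - 0) * Q1 + 0 * Q1') with Q1 in HH by ring.
    replace ((1 - 0) * Q2 + 0 * Q2') with Q2 in HH by ring.
    lra. }
  destruct (Hact X Y HSXY HlX HgM) as [HlX' HgZ].
  (* The violated inequality divided by [s] bounds the [gap] of the second pair by [2 s |g + S|^2];
     in the limit this contradicts [HgZ]. *)
  assert (Hfin : 0 <= 2 * 0 * ((gre X Y P1 Q1 Q2 + X) * (gre X Y P1 Q1 Q2 + X)
      + (gim X Y P2 Q1 Q2 + Y) * (gim X Y P2 Q1 Q2 + Y))
      - gap (exp (- 2 * (eta + 0 * 0 - l * X))) X Y P1' P2' Q1' Q2').
  { apply is_lim_seq_nonneg with (u := fun n =>
      2 * s (f n) * ((gre (zx (f n)) (zy (f n)) P1 Q1 Q2 + zx (f n)) * (gre (zx (f n)) (zy (f n)) P1 Q1 Q2 + zx (f n))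
      + (gim (zx (f n)) (zy (f n)) P2 Q1 Q2 + zy (f n)) * (gim (zx (f n)) (zy (f n)) P2 Q1 Q2 + zy (f n)))
      - gap (exp (- 2 * (eta + s (f n) * s (f n) - l * zx (f n)))) (zx (f n)) (zy (f n)) P1' P2' Q1' Q2').
    - assert (Lx : is_lim_seq (fun n => l * zx (f n)) (l * X)) by lim.
      destruct (is_lim_seq_eventually_lt _ _ eta Lx HlX') as [N HN].
      exists N. intros n Hn. specialize (HN n Hn).
      destruct (Hz (f n)) as [H1 [H2 H3]]. specialize (Hs (f n)).
      pose proof (HF _ _ H1 HN) as H4.
      set (x := zx (f n)) in *. set (y := zy (f n)) in *. set (t := s (f n)) in *.
      clearbody x y t. clear - Hs HN H1 H2 H3 H4.
      rewrite gap_convex_comb in H3.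
      pose proof (exp_neg_lt_1 (eta + t * t - l * x) ltac:(lra)) as HE1.
      pose proof (exp_neg_lt_1 (eta - l * x) ltac:(lra)) as HE0.
      (* Raising the exponent by [t^2] lowers [E] by at most [2 t^2], because
         [exp (- 2 t^2) >= 1 - 2 t^2]. *)
      assert (HE : exp (- 2 * (eta - l * x)) - exp (- 2 * (eta + t * t - l * x)) <= 2 * (t * t)).
      { replace (- 2 * (eta + t * t - l * x)) with (- 2 * (eta - l * x) + - 2 * (t * t)) by ring.
        rewrite exp_plus. pose proof (exp_ineq1_le (- 2 * (t * t))).
        pose proof (exp_pos (- 2 * (eta - l * x))). 
        set (E0 := exp (- 2 * (eta - l * x))) in *. set (d := exp (- 2 * (t * t))) in *.
        assert (E0 * (1 + - 2 * (t * t)) <= E0 * d) by (apply Rmult_le_compat_l; lra).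
        assert (0 <= t * t) by nra. nra. }
      set (E := exp (- 2 * (eta + t * t - l * x))) in *.
      set (E0 := exp (- 2 * (eta - l * x))) in *.
      set (W := (gre x y P1 Q1 Q2 + x) * (gre x y P1 Q1 Q2 + x)
          + (gim x y P2 Q1 Q2 + y) * (gim x y P2 Q1 Q2 + y)).
      assert (HW : 0 <= W) by apply sum_sqr_nonneg.
      assert (HM : gap E x y P1 P2 Q1 Q2 = gap E0 x y P1 P2 Q1 Q2 - (E0 - E) * W) by
        (unfold gap, W; ring).
      assert (HM2 : - (2 * (t * t) * W) <= gap E x y P1 P2 Q1 Q2).
      { rewrite HM. assert ((E0 - E) * W <= 2 * (t * t) * W) by (apply Rmult_le_compat_r; lra). lra. }
      set (gM := gap E x y P1 P2 Q1 Q2) in *. set (gZ := gap E x y P1' P2' Q1' Q2') in *.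
      set (rest := gre x y (P1 - P1') (Q1 - Q1') (Q2 - Q2') * _ + _) in H3.
      assert (Hrest : 0 <= t * (1 - t) * (1 - E) * rest).
      { apply Rmult_le_pos; [|apply sum_sqr_nonneg].
        repeat apply Rmult_le_pos; lra. }
      assert (HtW : 0 <= 2 * (t * t) * W) by (apply Rmult_le_pos; nra).
      assert ((1 - t) * - (2 * (t * t) * W) <= (1 - t) * gM) by (apply Rmult_le_compat_l; lra).
      assert (- (2 * (t * t) * W) <= (1 - t) * - (2 * (t * t) * W)) by nra.
      assert (t * gZ <= t * (2 * t * W)) by lra.
      assert (gZ <= 2 * t * W) by (apply Rmult_le_reg_l with t; lra).
      lra.
    - unfold gap, gre, gim. lim. }
  replace (eta + 0 * 0 - l * X) with (eta - l * X) in Hfin by ring. lra.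
Qed.

(** [(x^2 + y^2)^2] is determined by the real and imaginary parts of the square; this fixes [x^2],
    and the sign of [x] does the rest. *)
Lemma csquare_inj (x y x' y' : R) :
  0 < x -> 0 < x' -> x * x - y * y = x' * x' - y' * y' -> x * y = x' * y' -> x = x' /\ y = y'.
Proof.
  intros Hx Hx' H1 H2.
  assert (HN : x * x + y * y = x' * x' + y' * y').
  { assert (0 < x * x) by nra. assert (0 < x' * x') by nra.
    assert (0 <= y * y) by nra. assert (0 <= y' * y') by nra.
    apply Rsqr_inj; [lra | lra|]. unfold Rsqr.
    replace ((x * x + y * y) * (x * x + y * y)) with
      ((x * x - y * y) * (x * x - y * y) + 4 * ((x * y) * (x * y))) by ring.
    rewrite H1, H2. ring. }
  assert (Hxx : x = x') by (apply Rsqr_inj; unfold Rsqr; lra).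
  split; [exact Hxx|]. subst x'. apply Rmult_eq_reg_l with x; lra.
Qed.

(** The two imaginary parts are taken opposite so that the midpoint is real, and the sums positive
    so that it satisfies strictly the constraint on the edge [l x = eta], where strict concavity is
    lost. It is meant for two uses: a pair against its conjugate, then two real pairs. *)
Lemma optimum_unique (Sset : R -> R -> Prop) (l eta P1 P2 Q1 Q2 P1' Q1' : R) :
  0 < l ->
  (forall x y, Sset x y -> 0 < x /\ y * y <= x * x) ->
  (forall (u v : nat -> R) (x y : R), (forall n, Sset (u n) (v n)) ->
    is_lim_seq u x -> is_lim_seq v y -> Sset x y) ->
  (forall eta' A1 A2 B1 B2, eta < eta' -> ~ feas Sset l eta' A1 A2 B1 B2) ->
  feas Sset l eta P1 P2 Q1 Q2 -> feas Sset l eta P1' (- P2) Q1' (- Q2) ->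
  0 < P1 + P1' -> 0 < Q1 + Q1' ->
  P1 = P1' /\ P2 = 0 /\ Q1 = Q1' /\ Q2 = 0.
Proof.
  intros Hl Hb Hcl Hopt HF HF' HP HQ.
  apply Classical_Prop.NNPP. intros Hne.
  pose proof (feas_midpoint _ _ _ _ _ _ _ _ _ _ _ HF HF') as HM.
  set (dP1 := P1 - P1') in *. set (dP2 := P2 - - P2). set (dQ1 := Q1 - Q1'). set (dQ2 := Q2 - - Q2).
  (* If the midpoint has no slack at a point, the concavity gain is zero there: the difference of
     the two pairs gives [g = 0]. *)
  assert (HMz : forall x y, Sset x y -> l * x <= eta ->
     gap (exp (- 2 * (eta - l * x))) x y ((1 - /2) * P1 + /2 * P1') ((1 - /2) * P2 + /2 * - P2)
            ((1 - /2) * Q1 + /2 * Q1') ((1 - /2) * Q2 + /2 * - Q2) <= 0 ->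
     l * x < eta /\ gre x y dP1 dQ1 dQ2 = 0 /\ gim x y dP2 dQ1 dQ2 = 0).
  { intros x y Hxy Hx Hg. destruct (Hb _ _ Hxy) as [Hx0 Hyx].
    destruct (Rlt_le_dec (l * x) eta) as [Hlt|Hge].
    - split; [exact Hlt|]. rewrite gap_convex_comb in Hg. fold dP1 dP2 dQ1 dQ2 in Hg.
      pose proof (HF _ _ Hxy Hlt). pose proof (HF' _ _ Hxy Hlt).
      pose proof (exp_neg_lt_1 (eta - l * x) ltac:(lra)).
      set (E := exp _) in *. set (u := gre x y dP1 dQ1 dQ2) in *.
      set (v := gim x y dP2 dQ1 dQ2) in *.
      assert (Huv : u * u + v * v <= 0).
      { apply Rmult_le_reg_l with (/ 2 * (1 - / 2) * (1 - E)); lra. }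
      pose proof (Rle_0_sqr u); pose proof (Rle_0_sqr v); unfold Rsqr in *.
      split; apply Rsqr_0_uniq; unfold Rsqr; lra.
    - exfalso. replace ((1 - / 2) * P2 + / 2 * - P2) with 0 in Hg by field.
      replace ((1 - / 2) * Q2 + / 2 * - Q2) with 0 in Hg by field.
      assert (0 < gap (exp (- 2 * (eta - l * x))) x y ((1 - /2) * P1 + /2 * P1') 0
            ((1 - /2) * Q1 + /2 * Q1') 0); [|lra].
      apply gap_real_pos_of_ge1; try lra.
      replace (- 2 * (eta - l * x)) with 0 by lra. rewrite exp_0; lra. }
  assert (Hz : exists A1 A2 B1 B2, forall x y, Sset x y -> l * x <= eta ->
     gap (exp (- 2 * (eta - l * x))) x y ((1 - /2) * P1 + /2 * P1') ((1 - /2) * P2 + /2 * - P2)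
            ((1 - /2) * Q1 + /2 * Q1') ((1 - /2) * Q2 + /2 * - Q2) <= 0 ->
     l * x < eta /\ 0 < gap (exp (- 2 * (eta - l * x))) x y A1 A2 B1 B2).
  { destruct (Classical_Prop.classic (exists x0 y0, Sset x0 y0 /\ l * x0 < eta /\
      gre x0 y0 dP1 dQ1 dQ2 = 0 /\ gim x0 y0 dP2 dQ1 dQ2 = 0)) as [[x0 [y0 [H1 [H2 [H3 H4]]]]]|Hno].
    (* The perturbation is the constant [g = c S0], the centre of the disk at [S0], where [gap]
       equals [4E/(1-E) |S0|^2 > 0]. *)
    - set (E := exp (- 2 * (eta - l * x0))).
      set (c := (1 + E) / (1 - E)).
      exists (c * x0), (c * y0), 0, 0. intros x y Hxy Hx Hg.
      destruct (HMz x y Hxy Hx Hg) as [Hlt [H5 H6]]. split; [exact Hlt|].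
      destruct (Hb _ _ Hxy) as [Hx1 _]. destruct (Hb _ _ H1) as [Hx01 _].
      (* [dP + dQ S^2 = 0] with [dQ] nonzero determines [S^2], hence [S]; if [dQ] were zero then
         [dP] would be too and the pairs would coincide. *)
      assert (Hxx : x = x0 /\ y = y0).
      { unfold gre in H3, H5. unfold gim in H4, H6.
        set (a := x * x - y * y) in *. set (b := 2 * (x * y)) in *.
        set (a0 := x0 * x0 - y0 * y0) in *. set (b0 := 2 * (x0 * y0)) in *.
        assert (HN : 0 < dQ1 * dQ1 + dQ2 * dQ2).
        { destruct (sum_sqr_nonneg dQ1 dQ2) as [|HN]; [assumption | exfalso].
          pose proof (Rle_0_sqr dQ1); pose proof (Rle_0_sqr dQ2); unfold Rsqr in *.
          assert (Z1 : dQ1 = 0) by (apply Rsqr_0_uniq; unfold Rsqr; lra).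
          assert (Z2 : dQ2 = 0) by (apply Rsqr_0_uniq; unfold Rsqr; lra).
          rewrite Z1, Z2 in *. apply Hne. unfold dP1, dP2, dQ1, dQ2 in *. lra. }
        assert (Ea : a = a0).
        { apply Rmult_eq_reg_l with (dQ1 * dQ1 + dQ2 * dQ2); [|lra].
          assert (dQ1 * (a - a0) - dQ2 * (b - b0) = 0) by lra.
          assert (dQ1 * (b - b0) + dQ2 * (a - a0) = 0) by lra.
          assert (dQ1 * (dQ1 * (a - a0) - dQ2 * (b - b0)) + dQ2 * (dQ1 * (b - b0) + dQ2 * (a - a0)) = 0) by
            (rewrite H, H0; ring). lra. }
        assert (Eb : b = b0).
        { apply Rmult_eq_reg_l with (dQ1 * dQ1 + dQ2 * dQ2); [|lra].
          assert (dQ1 * (a - a0) - dQ2 * (b - b0) = 0) by lra.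
          assert (dQ1 * (b - b0) + dQ2 * (a - a0) = 0) by lra.
          assert (dQ1 * (dQ1 * (b - b0) + dQ2 * (a - a0)) - dQ2 * (dQ1 * (a - a0) - dQ2 * (b - b0)) = 0) by
            (rewrite H, H0; ring). lra. }
        apply csquare_inj; try assumption. unfold b, b0 in Eb. lra. }
      destruct Hxx as [-> ->]. fold E.
      pose proof (exp_neg_lt_1 (eta - l * x0) ltac:(lra)) as HE1.
      pose proof (exp_pos (- 2 * (eta - l * x0))) as HE0. fold E in HE1, HE0.
      replace (gap E x0 y0 (c * x0) (c * y0) 0 0) with (4 * E / (1 - E) * (x0 * x0 + y0 * y0)) by
        (unfold gap, gre, gim, c; field; lra).
      apply Rmult_lt_0_compat; [apply Rdiv_lt_0_compat; lra|].
      pose proof (Rle_0_sqr y0); unfold Rsqr in *. assert (0 < x0 * x0) by nra. lra.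
    - exists 0, 0, 0, 0. intros x y Hxy Hx Hg. exfalso. apply Hno.
      exists x, y. split; [exact Hxy|]. apply HMz; assumption. }
  destruct Hz as [A1 [A2 [B1 [B2 Hz]]]].
  destruct (feas_improve Sset l eta _ _ _ _ A1 A2 B1 B2 Hl Hb Hcl HM Hz)
    as [eta' [C1 [C2 [D1 [D2 [H1 H2]]]]]].
  exact (Hopt _ _ _ _ _ H1 H2).
Qed.

(** * Existence and uniqueness combined, for small [h] *)

(* The minimiser at [L] in the scaled variable [h = (8 A L / nu)^(1/5)], for which
   [L / (2 nu) = h^5 / (64 m)] with [m = A / 4]. *)
Definition optimal_at (Sset : R -> R -> Prop) (m h P Q eta : R) : Prop :=
  0 < P /\ 0 < Q /\ 0 < eta /\
  feas Sset (h ^ 5 / (64 * m)) eta P 0 Q 0 /\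
  (forall eta' A1 A2 B1 B2, eta < eta' -> ~ feas Sset (h ^ 5 / (64 * m)) eta' A1 A2 B1 B2) /\
  (forall A1 A2 B1 B2, feas Sset (h ^ 5 / (64 * m)) eta A1 A2 B1 B2 ->
     A1 = P /\ A2 = 0 /\ B1 = Q /\ B2 = 0).

Lemma abstract_best_approximation (Sset : R -> R -> Prop) (m t0 X0 : R) :
  symbol_region Sset m t0 X0 ->
  exists h0, 0 < h0 /\ forall h, 0 < h <= h0 ->
    exists P Q eta, optimal_at Sset m h P Q eta.
Proof.
  intros HS. pose proof HS as [Hm Hb [y1 Hmin] Ht0 HX0 Hfar Hconj Hcl].
  destruct (feasible_asymptotics Sset m t0 X0 (1/2) HS ltac:(lra)) as [h1 [Hh1 Has]].
  exists (Rmin h1 (Rmin (/ 100000) (m / (X0 + 1)))). split.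
  { repeat apply Rmin_pos; try lra. apply Rdiv_lt_0_compat; lra. }
  intros h Hh.
  assert (H1 : h <= h1) by (eapply Rle_trans; [apply Hh | apply Rmin_l]).
  assert (H2 : h <= / 100000).
  { eapply Rle_trans; [apply Hh|]. eapply Rle_trans; [apply Rmin_r | apply Rmin_l]. }
  assert (H3 : h * (X0 + 1) <= m).
  { assert (h <= m / (X0 + 1)).
    { eapply Rle_trans; [apply Hh|]. eapply Rle_trans; [apply Rmin_r | apply Rmin_r]. }
    apply Rmult_le_compat_r with (r := X0 + 1) in H; [|lra].
    replace (m / (X0 + 1) * (X0 + 1)) with m in H by (field; lra). exact H. }
  set (l := h ^ 5 / (64 * m)) in *.
  assert (Hl : 0 < l) by (unfold l; apply Rdiv_lt_0_compat; [apply pow_lt; lra | lra]).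
  (* [1/32 = (1/2)/16]: [eta1] is reached by the scaled pair, as [h <= 1/100000 < eps^2/64], and it
     is also the threshold from which [feasible_asymptotics] with accuracy [1/2] makes [P] and [Q]
     positive. *)
  set (eps := 1 / 32).
  set (eta1 := (1 - eps) * h).
  assert (Heta1 : eta1 = 31 / 32 * h) by (unfold eta1, eps; field).
  assert (Hb' : forall x y, Sset x y -> 0 < x /\ y * y <= x * x).
  { intros x y Hxy. destruct (Hb x y Hxy). split; lra. }
  assert (Hpos : forall eta A1 A2 B1 B2, eta1 <= eta -> feas Sset l eta A1 A2 B1 B2 ->
    0 < A1 /\ 0 < B1 /\ eta <= 2 * h).
  { intros eta A1 A2 B1 B2 He HF.
    destruct (Has h eta A1 A2 B1 B2 ltac:(lra) ltac:(lra) HF) as [HA [HB HE]].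
    apply Rabs_le_between in HA. apply Rabs_le_between in HB. apply Rabs_le_between in HE.
    assert (Hh3 : 0 < h ^ 3) by (apply pow_lt; lra).
    repeat split.
    - assert (0 < A1 * h / (2 * m)) as HA' by lra.
      apply Rmult_lt_reg_r with (h / (2 * m)); [apply Rdiv_lt_0_compat; lra|].
      unfold Rdiv in *; lra.
    - assert (0 < 16 * m * B1 / h ^ 3) as HB' by lra.
      apply Rmult_lt_reg_r with (16 * m / h ^ 3); [apply Rdiv_lt_0_compat; lra|].
      unfold Rdiv in *; lra.
    - assert (eta / h * h <= 2 * h) by (apply Rmult_le_compat_r; lra).
      replace (eta / h * h) with eta in H by (field; lra). lra. }
  destruct (optimal_eta_exists Sset l eta1 (2 * h)) as [eta [He [[A1 [A2 [B1 [B2 HF]]]] Hopt]]].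
  - exists (2 * m / h), 0, (h ^ 3 / (16 * m)), 0.
    apply scaling_test_feasible; auto; unfold eps; lra.
  - destruct (Hfar X0 (Rle_refl _)) as [Hf1 Hf2].
    exists X0, (sqrt (X0 * X0 - t0)). split; [exact Hf2|]. split; [apply Hconj, Hf2|].
    split; [exact HX0|]. split; [apply sqrt_lt_R0; lra|].
    split; [rewrite sqrt_sqrt; lra|].
    assert (El : l * (64 * m) = h * (h * h * (h * h))) by (unfold l; field; lra).
    assert (h * h <= h) by nra.
    assert (h * h * (h * h) <= h) by nra.
    apply Rmult_lt_reg_r with (64 * m); [lra|].
    replace (l * X0 * (64 * m)) with (h * (h * h * (h * h)) * X0) by (rewrite <- El; ring).
    rewrite Heta1.
    assert (h * h * (h * h) * X0 <= m).
    { assert (h * h * (h * h) * X0 <= h * X0) by (apply Rmult_le_compat_r; lra). lra. }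
    assert (h * (h * h * (h * h) * X0) <= h * m) by (apply Rmult_le_compat_l; lra).
    assert (0 < h * m) by (apply Rmult_lt_0_compat; lra). lra.
  - intros eta A1 A2 B1 B2 He HF. apply (Hpos eta A1 A2 B1 B2 He HF).
  - destruct (Hpos eta A1 A2 B1 B2 He HF) as [HA1 [HB1 _]].
    exists A1, B1, eta. split; [exact HA1|]. split; [exact HB1|]. split; [lra|].
    pose proof (feas_real_part _ _ _ _ _ _ _ Hconj HF) as HFr.
    split; [exact HFr|]. split; [exact Hopt|].
    intros C1 C2 D1 D2 HC. destruct (Hpos eta C1 C2 D1 D2 He HC) as [HC1 [HD1 _]].
    (* Comparison with the conjugate shows that the pair is real; a second comparison identifies it
       with [(A1, B1)]. *)
    destruct (optimum_unique Sset l eta C1 C2 D1 D2 C1 D1 Hl Hb' Hcl Hopt HC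
      (feas_conj _ _ _ _ _ _ _ Hconj HC) ltac:(lra) ltac:(lra)) as [_ [-> [_ ->]]].
    assert (HFr' : feas Sset l eta A1 (- 0) B1 (- 0)) by (rewrite Ropp_0; exact HFr).
    destruct (optimum_unique Sset l eta C1 0 D1 0 A1 B1 Hl Hb' Hcl Hopt
      (feas_real_part _ _ _ _ _ _ _ Hconj HC) HFr' ltac:(lra) ltac:(lra)) as [-> [_ [-> _]]].
    auto.
Qed.

(** * The minimum of [Re S] *)

(* The values of [S = root_sym]: [S^2 = x0^2 + 4 nu^2 k^2 + 4 i nu (w + c k)]. *)
Definition Sregion (nu a b c km wm x y : R) : Prop :=
  0 < x /\ exists w k, InD km wm w k /\
    x * x - y * y = x0sq nu a b + 4 * nu ^ 2 * k ^ 2 /\ x * y = 2 * nu * (w + c * k).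

(* [2 (Re S)^2] is the positive root [G] of [G^2 - 2 t G - 16 nu^2 xi^2], where [t = Re S^2]
   and [4 nu xi = Im S^2]. *)
Definition charpoly (nu t xi G : R) : R := G * G - 2 * t * G - 16 * nu ^ 2 * (xi * xi).

(** The product of the roots is [- 16 nu^2 xi^2 <= 0], so a positive root is the largest one. A
    nonpositive value at [G] thus certifies [G] as a lower bound for [2 (Re S)^2] without square
    roots. *)
Lemma charpoly_root_ge (nu t xi Y G : R) :
  0 < nu -> 0 < Y -> 0 < G -> charpoly nu t xi Y = 0 -> charpoly nu t xi G <= 0 -> G <= Y.
Proof.
  intros Hnu HY HG H1 H2. unfold charpoly in *.
  assert (H16 : 0 <= 16 * nu ^ 2 * (xi * xi)) by
    (apply Rmult_le_pos; [nra | apply Rle_0_sqr]).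
  assert (HY2 : 0 <= Y - 2 * t) by (apply Rmult_le_reg_l with Y; lra).
  destruct (Rle_lt_dec G Y) as [|Hlt]; [assumption | exfalso].
  assert (0 < (G - Y) * (G + (Y - 2 * t))) by (apply Rmult_lt_0_compat; lra). lra.
Qed.

Lemma charpoly_sqrt (nu t xi : R) :
  charpoly nu t xi (sqrt (t ^ 2 + 16 * nu ^ 2 * xi ^ 2) + t) = 0.
Proof.
  unfold charpoly.
  assert (H : 0 <= t ^ 2 + 16 * nu ^ 2 * xi ^ 2).
  { pose proof (pow2_ge_0 t); pose proof (pow2_ge_0 (4 * nu * xi)). lra. }
  pose proof (sqrt_sqrt _ H). set (r := sqrt _) in *. lra.
Qed.

(** With [G] fixed, [charpoly] along [xi = wm - C k] is a concave quadratic in [k] that vanishes at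
    [k0] with slope a positive multiple of [2 C (wm - C k0) - G k0]. It is nonpositive beyond [k0],
    and everywhere if the slope is zero; a larger [|xi|] only lowers it. *)
Lemma charpoly_along_boundary (nu x0s C wm k0 G k xi : R) :
  0 < nu -> 0 <= C -> 0 < G -> 0 <= k0 -> C * k0 <= wm -> 0 <= k ->
  charpoly nu (x0s + 4 * nu ^ 2 * k0 ^ 2) (wm - C * k0) G = 0 ->
  2 * C * (wm - C * k0) <= G * k0 ->
  (k0 <= k \/ 2 * C * (wm - C * k0) = G * k0) ->
  wm - C * k <= Rabs xi ->
  charpoly nu (x0s + 4 * nu ^ 2 * k ^ 2) xi G <= 0.
Proof.
  intros Hnu HC HG Hk0 HCk Hk Hz Hs Hd Hxi.
  assert (Hnu2 : 0 < nu ^ 2) by (apply pow_lt; lra).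
  assert (Hq : forall k', (k0 <= k' \/ 2 * C * (wm - C * k0) = G * k0) ->
    charpoly nu (x0s + 4 * nu ^ 2 * k' ^ 2) (wm - C * k') G <= 0).
  { intros k' Hk'.
    replace (charpoly nu (x0s + 4 * nu ^ 2 * k' ^ 2) (wm - C * k') G) with
      (charpoly nu (x0s + 4 * nu ^ 2 * k0 ^ 2) (wm - C * k0) G
       - 16 * nu ^ 2 * ((k' - k0) * (G * k0 - 2 * C * (wm - C * k0)))
       - (8 * nu ^ 2 * G + 16 * nu ^ 2 * (C * C)) * ((k' - k0) * (k' - k0))) by
      (unfold charpoly; ring).
    rewrite Hz.
    assert (0 <= (k' - k0) * (G * k0 - 2 * C * (wm - C * k0))).
    { destruct Hk' as [Hk'|Hk']; [apply Rmult_le_pos; lra | rewrite Hk'; lra]. }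
    assert (0 <= 16 * nu ^ 2 * ((k' - k0) * (G * k0 - 2 * C * (wm - C * k0)))) by
      (apply Rmult_le_pos; lra).
    assert (0 <= (8 * nu ^ 2 * G + 16 * nu ^ 2 * (C * C)) * ((k' - k0) * (k' - k0))).
    { apply Rmult_le_pos; [|apply Rle_0_sqr].
      assert (0 <= 8 * nu ^ 2 * G) by (apply Rmult_le_pos; lra).
      assert (0 <= 16 * nu ^ 2 * (C * C)) by (apply Rmult_le_pos; nra). lra. }
    lra. }
  destruct (Rle_lt_dec (C * k) wm) as [Hle|Hgt].
  - specialize (Hq k Hd). unfold charpoly in *.
    assert ((wm - C * k) * (wm - C * k) <= xi * xi).
    { replace (xi * xi) with (Rabs xi * Rabs xi) by
        (rewrite <- Rabs_mult; apply Rabs_pos_eq, Rle_0_sqr).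
      apply Rmult_le_compat; lra. }
    assert (16 * nu ^ 2 * ((wm - C * k) * (wm - C * k)) <= 16 * nu ^ 2 * (xi * xi)) by
      (apply Rmult_le_compat_l; lra).
    lra.
  (* Beyond [wm/C] the bound on [|xi|] is void. The value at [k' = wm/C], [xi = 0] is then an upper
     bound, since [charpoly] decreases in [t] and in [|xi|]. *)
  - assert (HCp : 0 < C) by (destruct HC as [|HC]; [assumption | subst C; lra]).
    set (k' := wm / C).
    assert (Ek' : C * k' = wm) by (unfold k'; field; lra).
    assert (Hk0' : k0 <= k') by (apply Rmult_le_reg_l with C; lra).
    assert (Hkk' : k' <= k) by (apply Rmult_le_reg_l with C; lra).
    specialize (Hq k' (or_introl Hk0')). unfold charpoly in *. rewrite Ek' in Hq.
    assert (k' ^ 2 <= k ^ 2) by (apply pow_incr; lra).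
    assert (4 * nu ^ 2 * k' ^ 2 <= 4 * nu ^ 2 * k ^ 2) by (apply Rmult_le_compat_l; lra).
    assert (2 * (x0s + 4 * nu ^ 2 * k' ^ 2) * G <= 2 * (x0s + 4 * nu ^ 2 * k ^ 2) * G) by
      (apply Rmult_le_compat_r; lra).
    assert (0 <= 16 * nu ^ 2 * (xi * xi)) by (apply Rmult_le_pos; [lra | apply Rle_0_sqr]).
    lra.
Qed.

(* The quadratic vanishing at [kbar] is, up to a positive factor, the derivative in [k] of [Re S]
   along the boundary [xi = wm - |c| k]. *)
Lemma boundary_derivative (nu x0s C wm k G : R) :
  0 < nu -> 0 <= C -> 0 < G -> 0 < k -> C * k <= wm ->
  charpoly nu (x0s + 4 * nu ^ 2 * k ^ 2) (wm - C * k) G = 0 ->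
  0 <= 4 * nu ^ 2 * wm * k ^ 2 + (C ^ 2 + x0s) * C * k - C ^ 2 * wm ->
  2 * C * (wm - C * k) <= G * k.
Proof.
  intros Hnu HC HG Hk HCk Hz HE.
  (* [Y] is the value of [G] at which the slope would vanish. [charpoly] at [Y] has the sign
     opposite to that of the quadratic in [k], which places [Y] below [G]. *)
  set (xi := wm - C * k) in *. set (Y := 2 * C * xi / k).
  assert (EY : Y * k = 2 * C * xi) by (unfold Y; field; lra).
  assert (HY : 0 <= Y).
  { unfold Y. apply Rmult_le_pos; [|apply Rlt_le, Rinv_0_lt_compat; lra].
    apply Rmult_le_pos; unfold xi; lra. }
  destruct HY as [HY|HY]; [|rewrite <- EY, <- HY; nra].
  rewrite <- EY. apply Rmult_le_compat_r; [lra|].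
  apply (charpoly_root_ge nu (x0s + 4 * nu ^ 2 * k ^ 2) xi); try assumption.
  replace (charpoly nu (x0s + 4 * nu ^ 2 * k ^ 2) xi Y) with
    (- (4 * xi / k ^ 2 * (4 * nu ^ 2 * wm * k ^ 2 + (C ^ 2 + x0s) * C * k - C ^ 2 * wm))) by
    (unfold charpoly, Y, xi; field; lra).
  assert (0 <= 4 * xi / k ^ 2).
  { apply Rmult_le_pos; [unfold xi; lra | apply Rlt_le, Rinv_0_lt_compat, pow_lt; lra]. }
  assert (0 <= 4 * xi / k ^ 2 * (4 * nu ^ 2 * wm * k ^ 2 + (C ^ 2 + x0s) * C * k - C ^ 2 * wm)) by
    (apply Rmult_le_pos; assumption).
  lra.
Qed.

(** When the quadratic vanishes, [2 C xi / k] is itself a positive root of [charpoly], and there is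
    only one. *)
Lemma boundary_stationary (nu x0s C wm k G : R) :
  0 < nu -> 0 < C -> 0 < G -> 0 < k -> C * k < wm ->
  charpoly nu (x0s + 4 * nu ^ 2 * k ^ 2) (wm - C * k) G = 0 ->
  4 * nu ^ 2 * wm * k ^ 2 + (C ^ 2 + x0s) * C * k - C ^ 2 * wm = 0 ->
  2 * C * (wm - C * k) = G * k.
Proof.
  intros Hnu HC HG Hk HCk Hz HE.
  set (xi := wm - C * k) in *. set (Y := 2 * C * xi / k).
  assert (EY : Y * k = 2 * C * xi) by (unfold Y; field; lra).
  assert (HY : 0 < Y).
  { unfold Y. apply Rdiv_lt_0_compat; [|lra]. apply Rmult_lt_0_compat; unfold xi; lra. }
  rewrite <- EY. f_equal.
  assert (HzY : charpoly nu (x0s + 4 * nu ^ 2 * k ^ 2) xi Y = 0).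
  { replace (charpoly nu (x0s + 4 * nu ^ 2 * k ^ 2) xi Y) with
    (- (4 * xi / k ^ 2 * (4 * nu ^ 2 * wm * k ^ 2 + (C ^ 2 + x0s) * C * k - C ^ 2 * wm))) by
    (unfold charpoly, Y, xi; field; lra).
    rewrite HE. ring. }
  apply Rle_antisym; apply (charpoly_root_ge nu (x0s + 4 * nu ^ 2 * k ^ 2) xi); try assumption; lra.
Qed.

(** [kbar] comes from the quadratic formula; [|c| kbar < wm] is read off the equation, because the
    coefficient [c^2 + x0^2] is at least [c^2]. *)
Lemma kbar_spec (nu a b c wm : R) :
  0 < nu -> 0 <= b -> 0 < wm ->
  let k := kbar nu a b c wm in
  0 <= k /\ (c <> 0 -> 0 < k) /\ Rabs c * k < wm /\
  4 * nu ^ 2 * wm * k ^ 2 + (Rabs c ^ 2 + x0sq nu a b) * Rabs c * k - Rabs c ^ 2 * wm = 0.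
Proof.
  intros Hnu Hb Hwm k. unfold k, kbar. clear k.
  set (C := Rabs c). assert (HC : 0 <= C) by apply Rabs_pos.
  assert (Hcc : c ^ 2 = C ^ 2) by (unfold C; symmetry; apply pow2_abs). rewrite Hcc.
  assert (Hx0 : 0 <= x0sq nu a b).
  { unfold x0sq. pose proof (pow2_ge_0 a). assert (0 <= nu * b) by (apply Rmult_le_pos; lra). lra. }
  set (s := C ^ 2 + x0sq nu a b). assert (Hs : C ^ 2 <= s) by (unfold s; lra).
  pose proof (pow2_ge_0 C) as HC2.
  assert (Hnw : 0 < nu ^ 2 * wm ^ 2) by (apply Rmult_lt_0_compat; apply pow_lt; lra).
  assert (Hnu2 : 0 < nu ^ 2) by (apply pow_lt; lra).
  assert (Hr0 : 0 <= s ^ 2 + 16 * nu ^ 2 * wm ^ 2) by (pose proof (pow2_ge_0 s); lra).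
  pose proof (sqrt_sqrt _ Hr0) as Hrr. pose proof (sqrt_pos (s ^ 2 + 16 * nu ^ 2 * wm ^ 2)) as Hr.
  set (r := sqrt _) in *.
  assert (Hrs : s < r) by (destruct (Rlt_le_dec s r); [assumption | exfalso; nra]).
  assert (Hden : 0 < 8 * nu ^ 2 * wm) by (apply Rmult_lt_0_compat; lra).
  set (k := C * (r - s) / (8 * nu ^ 2 * wm)).
  assert (Ek : k * (8 * nu ^ 2 * wm) = C * (r - s)) by (unfold k; field; lra).
  assert (Hk : 0 <= k).
  { unfold k. apply Rmult_le_pos; [apply Rmult_le_pos; lra | apply Rlt_le, Rinv_0_lt_compat; lra]. }
  assert (Hkpos : 0 < C -> 0 < k).
  { intros HCp. unfold k. apply Rdiv_lt_0_compat; [apply Rmult_lt_0_compat; lra | lra]. }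
  assert (HE : 4 * nu ^ 2 * wm * k ^ 2 + s * C * k - C ^ 2 * wm = 0).
  { apply Rmult_eq_reg_r with (16 * nu ^ 2 * wm); [|lra].
    replace ((4 * nu ^ 2 * wm * k ^ 2 + s * C * k - C ^ 2 * wm) * (16 * nu ^ 2 * wm)) with
      ((k * (8 * nu ^ 2 * wm)) * (k * (8 * nu ^ 2 * wm)) + 2 * s * C * (k * (8 * nu ^ 2 * wm))
       - C ^ 2 * (16 * nu ^ 2 * wm ^ 2)) by ring.
    rewrite Ek. replace (16 * nu ^ 2 * wm ^ 2) with (r * r - s ^ 2) by lra. ring. }
  split; [exact Hk|]. split.
  { intros Hc. apply Hkpos, Rabs_pos_lt, Hc. }
  split; [|exact HE].
  destruct HC as [HC|HC]; [|rewrite <- HC; lra].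
  specialize (Hkpos HC).
  assert (0 < 4 * nu ^ 2 * wm * k ^ 2) by
    (apply Rmult_lt_0_compat; [lra | apply pow_lt; lra]).
  assert (C ^ 2 * (C * k) <= s * (C * k)) by
    (apply Rmult_le_compat_r; [apply Rmult_le_pos; lra | lra]).
  apply Rmult_lt_reg_l with (C ^ 2); [apply pow_lt; lra | lra].
Qed.

(** [phi^2 / 8] is [2 (Re S)^2], so [phi] is four times [Re S]; this is where [m = A/4] comes from.
    The last hypothesis rules out [S = 0]. *)
Lemma phi_charpoly (nu a b k xi : R) :
  0 < nu -> 0 <= b -> (0 < k \/ xi <> 0) ->
  0 < phi nu a b k xi /\
  charpoly nu (x0sq nu a b + 4 * nu ^ 2 * k ^ 2) xi (phi nu a b k xi ^ 2 / 8) = 0.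
Proof.
  intros Hnu Hb Hpos. unfold phi.
  set (t := x0sq nu a b + 4 * nu ^ 2 * k ^ 2).
  assert (Hnu2 : 0 < nu ^ 2) by (apply pow_lt; lra).
  assert (Ht0 : 4 * nu ^ 2 * k ^ 2 <= t).
  { unfold t, x0sq. pose proof (pow2_ge_0 a). assert (0 <= nu * b) by (apply Rmult_le_pos; lra). lra. }
  assert (Hk2 : 0 <= 4 * nu ^ 2 * k ^ 2) by
    (apply Rmult_le_pos; [lra | apply pow2_ge_0]).
  assert (Hxi2 : 0 <= 16 * nu ^ 2 * xi ^ 2) by
    (apply Rmult_le_pos; [lra | apply pow2_ge_0]).
  assert (HG : 0 < sqrt (t ^ 2 + 16 * nu ^ 2 * xi ^ 2) + t).
  { destruct Hpos as [Hk|Hxi].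
    - assert (0 < 4 * nu ^ 2 * k ^ 2) by (apply Rmult_lt_0_compat; [lra | apply pow_lt; lra]).
      pose proof (sqrt_pos (t ^ 2 + 16 * nu ^ 2 * xi ^ 2)). lra.
    - assert (0 < 16 * nu ^ 2 * xi ^ 2) by
        (apply Rmult_lt_0_compat; [lra|]; rewrite <- Rsqr_pow2; apply Rsqr_pos_lt; exact Hxi).
      pose proof (pow2_ge_0 t).
      assert (0 < sqrt (t ^ 2 + 16 * nu ^ 2 * xi ^ 2)) by (apply sqrt_lt_R0; lra). lra. }
  split.
  - repeat apply Rmult_lt_0_compat; try lra; apply sqrt_lt_R0; lra.
  - set (G := sqrt (t ^ 2 + _) + t) in *.
    replace ((2 * sqrt 2 * sqrt G) ^ 2 / 8) with G.
    + apply charpoly_sqrt.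
    + rewrite !Rpow_mult_distr, !pow2_sqrt by lra. field.
Qed.

(** In terms of [Re S]: its minimum over the domain is [A/4], and it is attained. The cases are that
    the stationary point [kbar] of the boundary curve is admissible, that [km] lies past it and
    [Re S] increases along the curve, or that [xi = 0] is reachable at [km]. *)
Lemma Aconst_extremal (nu a b c km wm : R) :
  0 < nu -> 0 <= b -> 0 <= km -> 0 < wm ->
  let A := Aconst nu a b c km wm in
  0 < A /\
  (forall w k, InD km wm w k ->
     charpoly nu (x0sq nu a b + 4 * nu ^ 2 * k ^ 2) (w + c * k) (A ^ 2 / 8) <= 0) /\
  (exists w k, InD km wm w k /\
     charpoly nu (x0sq nu a b + 4 * nu ^ 2 * k ^ 2) (w + c * k) (A ^ 2 / 8) = 0).
Proof.
  intros Hnu Hb Hkm Hwm A. unfold A, Aconst. clear A.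
  destruct (kbar_spec nu a b c wm Hnu Hb Hwm) as [Hk0 [Hk1 [Hk2 HE]]].
  set (kb := kbar nu a b c wm) in *. set (C := Rabs c) in *.
  assert (HC : 0 <= C) by apply Rabs_pos.
  assert (Hx0 : 0 <= x0sq nu a b).
  { unfold x0sq. pose proof (pow2_ge_0 a). assert (0 <= nu * b) by (apply Rmult_le_pos; lra). lra. }
  assert (Hnu2 : 0 < nu ^ 2) by (apply pow_lt; lra).
  assert (HxiC : forall w k, InD km wm w k -> wm - C * Rabs k <= Rabs (w + c * k)).
  { intros w k [Hw _]. unfold C. rewrite <- Rabs_mult.
    pose proof (Rabs_triang (w + c * k) (- (c * k))) as HT.
    replace (w + c * k + - (c * k)) with w in HT by ring. rewrite Rabs_Ropp in HT. lra. }
  assert (Hsq : forall xi xi' t G, xi * xi = xi' * xi' -> charpoly nu t xi G = charpoly nu t xi' G).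
  { intros xi xi' t G Hxx. unfold charpoly. rewrite Hxx. reflexivity. }
  (* The sign of [k] is opposite to that of [c], so that the drift term [c k] is subtracted from
     [w = wm]. *)
  assert (Hatt : forall k0, km <= k0 -> C * k0 <= wm -> exists w k, InD km wm w k /\
    k ^ 2 = k0 ^ 2 /\ (w + c * k) * (w + c * k) = (- wm + C * k0) * (- wm + C * k0)).
  { intros k0 Hk Hck. destruct (Rle_lt_dec 0 c) as [Hc|Hc].
    - exists wm, (- k0). unfold InD. rewrite Rabs_Ropp, !Rabs_pos_eq by lra.
      split; [lra|]. split; [ring|]. unfold C. rewrite Rabs_pos_eq by lra. ring.
    - exists wm, k0. unfold InD. rewrite !Rabs_pos_eq by lra.
      split; [lra|]. split; [ring|]. unfold C. rewrite Rabs_left by lra. ring. }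
  assert (Habs : forall k : R, Rabs k ^ 2 = k ^ 2) by apply pow2_abs.
  destruct (Rle_dec km kb) as [Hle|Hgt]; [|destruct (Rle_dec (km * C) wm) as [Hle2|Hgt2]].
  - destruct (phi_charpoly nu a b kb (- wm + C * kb) Hnu Hb ltac:(right; lra)) as [HA Hz].
    set (A := phi nu a b kb (- wm + C * kb)) in *. split; [exact HA|].
    assert (HG : 0 < A ^ 2 / 8) by (apply Rdiv_lt_0_compat; [apply pow_lt; lra | lra]).
    assert (Hz' : charpoly nu (x0sq nu a b + 4 * nu ^ 2 * kb ^ 2) (wm - C * kb) (A ^ 2 / 8) = 0) by
      (rewrite <- Hz; apply Hsq; ring).
    split.
    + intros w k Hwk. rewrite <- (Habs k).
      assert (Hst : 2 * C * (wm - C * kb) = A ^ 2 / 8 * kb).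
      { destruct (Req_dec c 0) as [Hc|Hc].
        - assert (C = 0) by (unfold C; rewrite Hc; apply Rabs_R0).
          assert (kb = 0) as ->; [|rewrite H; ring].
          unfold kb, kbar. fold C. rewrite H. unfold Rdiv. ring.
        - apply (boundary_stationary nu (x0sq nu a b)); auto. apply Rabs_pos_lt, Hc. }
      apply (charpoly_along_boundary nu (x0sq nu a b) C wm kb); auto; try lra.
      apply Rabs_pos.
    + destruct (Hatt kb Hle ltac:(lra)) as [w [k [H1 [H2 H3]]]].
      exists w, k. split; [exact H1|]. rewrite H2, <- Hz. apply Hsq; exact H3.
  - assert (Hkm0 : 0 < km) by lra.
    destruct (phi_charpoly nu a b km (- wm + C * km) Hnu Hb (or_introl Hkm0)) as [HA Hz].
    set (A := phi nu a b km (- wm + C * km)) in *. split; [exact HA|].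
    assert (HG : 0 < A ^ 2 / 8) by (apply Rdiv_lt_0_compat; [apply pow_lt; lra | lra]).
    assert (Hz' : charpoly nu (x0sq nu a b + 4 * nu ^ 2 * km ^ 2) (wm - C * km) (A ^ 2 / 8) = 0) by
      (rewrite <- Hz; apply Hsq; ring).
    split.
    + intros w k Hwk. rewrite <- (Habs k).
      apply (charpoly_along_boundary nu (x0sq nu a b) C wm km); auto; try lra.
      * apply Rabs_pos.
      * apply (boundary_derivative nu (x0sq nu a b)); auto; try lra.
        assert (kb ^ 2 <= km ^ 2) by (apply pow_incr; lra).
        assert (4 * nu ^ 2 * wm * kb ^ 2 <= 4 * nu ^ 2 * wm * km ^ 2).
        { apply Rmult_le_compat_l; [apply Rmult_le_pos; lra | lra]. }
        assert ((C ^ 2 + x0sq nu a b) * C * kb <= (C ^ 2 + x0sq nu a b) * C * km).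
        { apply Rmult_le_compat_l; [|lra]. pose proof (pow2_ge_0 C). apply Rmult_le_pos; lra. }
        lra.
      * left. apply Hwk.
    + destruct (Hatt km ltac:(lra) ltac:(lra)) as [w [k [H1 [H2 H3]]]].
      exists w, k. split; [exact H1|]. rewrite H2, <- Hz. apply Hsq; exact H3.
  - assert (Hkm0 : 0 < km) by lra.
    destruct (phi_charpoly nu a b km 0 Hnu Hb (or_introl Hkm0)) as [HA Hz].
    set (A := phi nu a b km 0) in *. split; [exact HA|].
    assert (HG : 0 < A ^ 2 / 8) by (apply Rdiv_lt_0_compat; [apply pow_lt; lra | lra]).
    split.
    + intros w k [_ Hk]. rewrite <- (Habs k). unfold charpoly in *.
      assert (km ^ 2 <= Rabs k ^ 2) by (apply pow_incr; lra).
      assert (4 * nu ^ 2 * km ^ 2 <= 4 * nu ^ 2 * Rabs k ^ 2) by (apply Rmult_le_compat_l; lra).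
      assert (2 * (x0sq nu a b + 4 * nu ^ 2 * km ^ 2) * (A ^ 2 / 8) <=
              2 * (x0sq nu a b + 4 * nu ^ 2 * Rabs k ^ 2) * (A ^ 2 / 8)) by
        (apply Rmult_le_compat_r; lra).
      assert (0 <= 16 * nu ^ 2 * ((w + c * k) * (w + c * k))) by
        (apply Rmult_le_pos; [lra | apply Rle_0_sqr]).
      lra.
    (* This [w] cancels the imaginary part; it is admissible because [|c| km > wm] in this case. *)
    + exists (- (c * km)), km. split.
      * unfold InD. rewrite Rabs_Ropp, Rabs_mult, (Rabs_pos_eq km) by lra. fold C. lra.
      * rewrite <- Hz. apply Hsq; ring.
Qed.

Lemma Sregion_symbol_region (nu a b c km wm : R) :
  0 < nu -> 0 <= b -> 0 <= km -> 0 < wm ->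
  exists t0 X0, symbol_region (Sregion nu a b c km wm) (Aconst nu a b c km wm / 4) t0 X0.
Proof.
  intros Hnu Hb Hkm Hwm.
  destruct (Aconst_extremal nu a b c km wm Hnu Hb Hkm Hwm) as [HA [Hmin [w0 [k0 [HD0 Hz0]]]]].
  set (A := Aconst nu a b c km wm) in *.
  assert (HG : 0 < A ^ 2 / 8) by (apply Rdiv_lt_0_compat; [apply pow_lt; lra | lra]).
  assert (Hx0 : 0 <= x0sq nu a b).
  { unfold x0sq. pose proof (pow2_ge_0 a). assert (0 <= nu * b) by (apply Rmult_le_pos; lra). lra. }
  assert (Hnu2 : 0 < nu ^ 2) by (apply pow_lt; lra).
  assert (Htk : forall k, 0 <= x0sq nu a b + 4 * nu ^ 2 * k ^ 2).
  { intros k. assert (0 <= 4 * nu ^ 2 * k ^ 2) by (apply Rmult_le_pos; [lra | apply pow2_ge_0]). lra. }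
  (* [t0] is [Re S^2] on the line [k = km]; letting [w] grow on this line traces the hyperbola
     [x^2 - y^2 = t0], which supplies the far points. *)
  set (t0 := x0sq nu a b + 4 * nu ^ 2 * km ^ 2). pose proof (Htk km) as Ht0. fold t0 in Ht0.
  set (W := 4 * nu * (wm + Rabs c * km)).
  assert (HW : 0 <= W).
  { unfold W. assert (0 <= Rabs c * km) by (apply Rmult_le_pos; [apply Rabs_pos | lra]).
    apply Rmult_le_pos; lra. }
  exists t0, (1 + 2 * t0 + W).
  assert (Hbd : forall x y, Sregion nu a b c km wm x y -> A / 4 <= x /\ y * y <= x * x).
  { intros x y [Hx [w [k [HD [H1 H2]]]]]. split; [|pose proof (Htk k); lra].
    apply Rle_of_sqr_le; [lra|].
    assert (A ^ 2 / 8 <= 2 * (x * x)); [|lra].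
    apply (charpoly_root_ge nu (x0sq nu a b + 4 * nu ^ 2 * k ^ 2) (w + c * k)); auto.
    - nra.
    - unfold charpoly. rewrite <- H1.
      replace (16 * nu ^ 2 * ((w + c * k) * (w + c * k))) with
        (4 * (2 * nu * (w + c * k)) * (2 * nu * (w + c * k))) by ring.
      rewrite <- H2. ring. }
  constructor.
  - lra.
  - exact Hbd.
  - exists (2 * nu * (w0 + c * k0) / (A / 4)). split; [lra|].
    exists w0, k0. split; [exact HD0|]. split; [|field; lra].
    unfold charpoly in Hz0. set (t := x0sq nu a b + 4 * nu ^ 2 * k0 ^ 2) in *.
    assert (HA2 : 0 < A ^ 2) by (apply pow_lt; lra).
    apply Rmult_eq_reg_r with (A ^ 2 / 4); [|lra].
    replace ((A / 4 * (A / 4) - 2 * nu * (w0 + c * k0) / (A / 4) * (2 * nu * (w0 + c * k0) / (A / 4))) * (A ^ 2 / 4))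
      with (A ^ 2 / 8 * (A ^ 2 / 8) - 16 * nu ^ 2 * ((w0 + c * k0) * (w0 + c * k0))) by (field; lra).
    lra.
  - exact Ht0.
  - lra.
  - intros x Hx.
    assert (Hx1 : 1 <= x) by lra.
    assert (Hxx : 1 + 2 * t0 + W <= x * x) by nra.
    split; [lra|].
    assert (Hs : sqrt (x * x - t0) * sqrt (x * x - t0) = x * x - t0) by (apply sqrt_sqrt; lra).
    pose proof (sqrt_pos (x * x - t0)) as Hsp. set (y := sqrt (x * x - t0)) in *.
    split; [lra|].
    (* [w] is solved from [x y = 2 nu (w + c km)]. The choice of [W] makes [x y] large enough for
       [w >= wm]. *)
    exists (x * y / (2 * nu) - c * km), km. split; [|split; [unfold t0 in Hs; lra | field; lra]].
    split; [|rewrite Rabs_pos_eq; lra].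
    assert (Hy2 : x <= 2 * y) by (apply Rle_of_sqr_le; lra).
    assert (Hxy : x * x <= 2 * (x * y)) by nra.
    assert (HWxy : wm + Rabs c * km <= x * y / (2 * nu)).
    { apply Rmult_le_reg_r with (4 * nu); [lra|].
      replace (x * y / (2 * nu) * (4 * nu)) with (2 * (x * y)) by (field; lra).
      unfold W in *. lra. }
    assert (c * km <= Rabs c * km) by (apply Rmult_le_compat_r; [lra | apply Rle_abs]).
    eapply Rle_trans; [|apply Rle_abs]. lra.
  - intros x y [Hx [w [k [[HD1 HD2] [H1 H2]]]]]. split; [exact Hx|].
    exists (- w), (- k). split; [split; rewrite Rabs_Ropp; assumption|].
    split.
    + replace ((- k) ^ 2) with (k ^ 2) by ring. rewrite <- H1. ring.
    + replace (x * - y) with (- (x * y)) by ring. rewrite H2. ring.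
  (* Closedness: [w] is eliminated through the product [x y], and [4 nu^2 k^2 <= (Re S)^2] bounds
     the frequencies [k], which then subconverge. *)
  - intros u v x y HS Lu Lv.
    assert (Hk : forall n, exists k, InD km wm (u n * v n / (2 * nu) - c * k) k /\
      u n * u n - v n * v n = x0sq nu a b + 4 * nu ^ 2 * k ^ 2).
    { intros n. destruct (HS n) as [_ [w [k [HD [H1 H2]]]]]. exists k. split; [|exact H1].
      rewrite H2. replace (2 * nu * (w + c * k) / (2 * nu) - c * k) with w by (field; lra).
      exact HD. }
    set (ks := fun n => proj1_sig (constructive_indefinite_description _ (Hk n))).
    assert (Hks : forall n, InD km wm (u n * v n / (2 * nu) - c * ks n) (ks n) /\
      u n * u n - v n * v n = x0sq nu a b + 4 * nu ^ 2 * ks n ^ 2).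
    { intros n. unfold ks. destruct constructive_indefinite_description; assumption. }
    clearbody ks.
    (* The bound on [u] holds only from some rank [N] on, hence the shift of all indices by [N]. *)
    destruct (is_lim_seq_eventually_lt u x (Rabs x + 1) Lu) as [N HN].
    { pose proof (Rle_abs x). lra. }
    assert (HB : forall n, Rabs (ks (n + N)%nat) <= (Rabs x + 1) / (2 * nu)).
    { intros n. apply Rmult_le_reg_r with (2 * nu); [lra|].
      replace ((Rabs x + 1) / (2 * nu) * (2 * nu)) with (Rabs x + 1) by (field; lra).
      assert (Hn := HN (n + N)%nat ltac:(lia)). destruct (Hks (n + N)%nat) as [_ H2].
      destruct (HS (n + N)%nat) as [Hu _].
      apply Rle_trans with (u (n + N)%nat); [|lra].
      apply Rle_of_sqr_le; [lra|].
      replace (Rabs (ks (n + N)%nat) * (2 * nu) * (Rabs (ks (n + N)%nat) * (2 * nu))) with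
        (4 * nu ^ 2 * Rabs (ks (n + N)%nat) ^ 2) by ring.
      rewrite pow2_abs. pose proof (Rle_0_sqr (v (n + N)%nat)); unfold Rsqr in *; lra. }
    destruct (bounded_subsequence _ _ HB) as [f [k [Hf Lk]]].
    assert (HfN : filterlim (fun n => (f n + N)%nat) eventually eventually).
    { apply filterlim_comp with (G := eventually) (g := fun n => (n + N)%nat); [exact Hf|].
      apply eventually_subseq. intros n; lia. }
    apply (is_lim_seq_subseq _ _ _ HfN) in Lu. apply (is_lim_seq_subseq _ _ _ HfN) in Lv.
    assert (Hxm : A / 4 <= x).
    { assert (0 <= x - A / 4); [|lra].
      apply is_lim_seq_nonneg with (u := fun n => u (f n + N)%nat - A / 4); [|lim].
      exists O. intros n _. pose proof (proj1 (Hbd _ _ (HS (f n + N)%nat))). lra. }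
    split; [lra|]. exists (x * y / (2 * nu) - c * k), k. split; [|split].
    + assert (Lw : is_lim_seq (fun n => u (f n + N)%nat * v (f n + N)%nat / (2 * nu) - c * ks (f n + N)%nat)
        (x * y / (2 * nu) - c * k)).
      { unfold Rdiv. lim. }
      apply is_lim_seq_abs in Lw. simpl in Lw.
      assert (Lk' := is_lim_seq_abs _ _ Lk). simpl in Lk'.
      split.
      * assert (0 <= Rabs (x * y / (2 * nu) - c * k) - wm); [|lra].
        eapply is_lim_seq_nonneg; [|apply (is_lim_seq_minus' _ _ _ _ Lw (is_lim_seq_const wm))].
        exists O. intros n _. destruct (Hks (f n + N)%nat) as [[H1 _] _]. lra.
      * assert (0 <= Rabs k - km); [|lra].
        eapply is_lim_seq_nonneg; [|apply (is_lim_seq_minus' _ _ _ _ Lk' (is_lim_seq_const km))].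
        exists O. intros n _. destruct (Hks (f n + N)%nat) as [[_ H1] _]. lra.
    + assert (E1 : is_lim_seq (fun n => u (f n + N)%nat * u (f n + N)%nat - v (f n + N)%nat * v (f n + N)%nat)
        (x * x - y * y)) by lim.
      assert (E2 : is_lim_seq (fun n => u (f n + N)%nat * u (f n + N)%nat - v (f n + N)%nat * v (f n + N)%nat)
        (x0sq nu a b + 4 * nu ^ 2 * (k * (k * 1)))).
      { apply is_lim_seq_ext with (fun n => x0sq nu a b + 4 * nu ^ 2 * (ks (f n + N)%nat * (ks (f n + N)%nat * 1))).
        - intros n. symmetry. apply (Hks (f n + N)%nat).
        - lim. }
      apply is_lim_seq_unique in E1. apply is_lim_seq_unique in E2.
      rewrite E1 in E2. injection E2. intros ->. ring.
    + field. lra.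
Qed.

(** * The convergence factor *)

Lemma Cmod_sqr (z : C) : Cmod z * Cmod z = fst z * fst z + snd z * snd z.
Proof.
  unfold Cmod. rewrite sqrt_sqrt; [ring|].
  pose proof (pow2_ge_0 (fst z)); pose proof (pow2_ge_0 (snd z)); lra.
Qed.

Lemma csqrt_spec (z : C) :
  0 <= fst (csqrt z) /\
  fst (csqrt z) * fst (csqrt z) - snd (csqrt z) * snd (csqrt z) = Re z /\
  2 * (fst (csqrt z) * snd (csqrt z)) = Im z.
Proof.
  unfold csqrt; cbv zeta; cbn [fst snd].
  assert (Hr2 : Cmod z * Cmod z = Re z * Re z + Im z * Im z) by apply Cmod_sqr.
  pose proof (Cmod_ge_0 z) as Hr0. set (r := Cmod z) in *.
  assert (Hre : - r <= Re z <= r) by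
    (pose proof (Rle_0_sqr (Im z)); unfold Rsqr in *; split; nra).
  split; [apply sqrt_pos|].
  pose proof (sqrt_sqrt ((r + Re z) / 2) ltac:(lra)) as H1.
  pose proof (sqrt_sqrt ((r - Re z) / 2) ltac:(lra)) as H2.
  assert (H3 : sqrt ((r + Re z) / 2) * sqrt ((r - Re z) / 2) = Rabs (Im z) / 2).
  { rewrite <- sqrt_mult by lra.
    replace ((r + Re z) / 2 * ((r - Re z) / 2)) with (Rsqr (Im z / 2)) by (unfold Rsqr; lra).
    rewrite sqrt_Rsqr_abs, Rabs_div, (Rabs_pos_eq 2) by lra. reflexivity. }
  set (u := sqrt ((r + Re z) / 2)) in *. set (v := sqrt ((r - Re z) / 2)) in *.
  destruct (Rle_dec 0 (Im z)) as [Hi|Hi];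
    [rewrite (Rabs_pos_eq (Im z)) in H3 by lra | rewrite (Rabs_left (Im z)) in H3 by lra];
    split; lra.
Qed.

Lemma root_sym_spec (nu a b c w k : R) :
  let S := root_sym nu a b c w k in
  0 <= fst S /\ fst S * fst S - snd S * snd S = x0sq nu a b + 4 * nu ^ 2 * k ^ 2 /\
  fst S * snd S = 2 * nu * (w + c * k).
Proof.
  intros S. unfold S, root_sym.
  destruct (csqrt_spec (RtoC (x0sq nu a b) + RtoC (4 * nu) * zsym nu c w k)%C) as [H1 [H2 H3]].
  set (s := csqrt _) in *. split; [exact H1|]. split.
  - rewrite H2. unfold zsym; simpl. ring.
  - assert (H4 : 2 * (fst s * snd s) = 4 * nu * (w + c * k)) by
      (rewrite H3; unfold zsym; simpl; ring). lra.
Qed.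

(** With [x = 0], [charpoly] at [G = A^2/8] would be [G^2 + 2 y^2 G > 0], against the extremality of
    [A]; hence [S] is off the imaginary axis. *)
Lemma root_sym_Sregion (nu a b c km wm w k : R) :
  0 < nu -> 0 <= b -> 0 <= km -> 0 < wm -> InD km wm w k ->
  Sregion nu a b c km wm (fst (root_sym nu a b c w k)) (snd (root_sym nu a b c w k)).
Proof.
  intros Hnu Hb Hkm Hwm HD.
  destruct (root_sym_spec nu a b c w k) as [H1 [H2 H3]].
  set (S := root_sym nu a b c w k) in *.
  destruct H1 as [H1|H1]; [split; [exact H1 | eauto 6]|exfalso].
  destruct (Aconst_extremal nu a b c km wm Hnu Hb Hkm Hwm) as [HA [Hmin _]].
  specialize (Hmin w k HD). unfold charpoly in Hmin. rewrite <- H2 in Hmin.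
  replace (16 * nu ^ 2 * ((w + c * k) * (w + c * k))) with
    (4 * (2 * nu * (w + c * k)) * (2 * nu * (w + c * k))) in Hmin by ring.
  rewrite <- H3, <- H1 in Hmin. set (A := Aconst nu a b c km wm) in *.
  assert (HA2 : 0 < A ^ 2 / 8) by (apply Rdiv_lt_0_compat; [apply pow_lt; lra | lra]).
  assert (0 <= snd S * snd S) by apply Rle_0_sqr.
  assert (0 < A ^ 2 / 8 * (A ^ 2 / 8)) by (apply Rmult_lt_0_compat; lra).
  assert (0 <= snd S * snd S * (A ^ 2 / 8)) by (apply Rmult_le_pos; lra).
  lra.
Qed.

Lemma root_sym_eq (nu a b c km wm w k x y : R) :
  0 < nu -> 0 <= b -> 0 <= km -> 0 < wm -> InD km wm w k -> 0 <= x ->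
  x * x - y * y = x0sq nu a b + 4 * nu ^ 2 * k ^ 2 -> x * y = 2 * nu * (w + c * k) ->
  root_sym nu a b c w k = (x, y).
Proof.
  intros Hnu Hb Hkm Hwm HD Hx H1 H2.
  destruct (root_sym_Sregion nu a b c km wm w k Hnu Hb Hkm Hwm HD) as [HS _].
  destruct (root_sym_spec nu a b c w k) as [_ [H3 H4]].
  destruct (root_sym nu a b c w k) as [x' y']. simpl in *.
  destruct Hx as [Hx|Hx].
  - destruct (csquare_inj x' y' x y HS Hx ltac:(lra) ltac:(lra)) as [-> ->]. reflexivity.
  - exfalso. subst x. assert (Hy' : y' = 0) by (apply Rmult_eq_reg_l with x'; lra).
    subst y'. assert (0 < x' * x') by nra. pose proof (Rle_0_sqr y). unfold Rsqr in *. lra.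
Qed.

Lemma Cmod_cexp (z : C) : Cmod (cexp z) = exp (Re z).
Proof.
  unfold cexp, Cmod; cbn [fst snd].
  replace ((exp (Re z) * cos (Im z)) ^ 2 + (exp (Re z) * sin (Im z)) ^ 2) with
    (Rsqr (exp (Re z)) * (Rsqr (sin (Im z)) + Rsqr (cos (Im z)))) by (unfold Rsqr; ring).
  rewrite sin2_cos2, Rmult_1_r, sqrt_Rsqr; [reflexivity | apply Rlt_le, exp_pos].
Qed.

(* The change of unknowns [P = p - q x0^2 / (4 nu)], [Q = q / (4 nu)] makes
   [p + q z = P + Q S^2]. *)
Lemma symbol_components (nu a b c w k x y : R) (p q : C) :
  0 < nu -> x * x - y * y = x0sq nu a b + 4 * nu ^ 2 * k ^ 2 -> x * y = 2 * nu * (w + c * k) ->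
  (p + q * zsym nu c w k)%C =
  (gre x y (fst p - fst q * x0sq nu a b / (4 * nu)) (fst q / (4 * nu)) (snd q / (4 * nu)),
   gim x y (snd p - snd q * x0sq nu a b / (4 * nu)) (fst q / (4 * nu)) (snd q / (4 * nu))).
Proof.
  intros Hnu H1 H2. unfold gre, gim. rewrite H1, H2.
  destruct p as [p1 p2], q as [q1 q2]. unfold Cplus, Cmult, zsym; simpl.
  f_equal; field; lra.
Qed.

(** Clear the denominator and square. At a pole with [S] nonzero the equivalence breaks: the left
    side holds by the division convention while [gap = - 4 |S|^2]. *)
Lemma rho_le_iff_gap (nu a b c w k L eta : R) (p q : C) :
  0 < nu ->
  let x := fst (root_sym nu a b c w k) in
  let y := snd (root_sym nu a b c w k) in
  let P1 := fst p - fst q * x0sq nu a b / (4 * nu) in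
  let P2 := snd p - snd q * x0sq nu a b / (4 * nu) in
  let Q1 := fst q / (4 * nu) in
  let Q2 := snd q / (4 * nu) in
  ~ (gre x y P1 Q1 Q2 + x = 0 /\ gim x y P2 Q1 Q2 + y = 0) ->
  Cmod (rho nu a b c w k p q L) <= exp (- eta) <->
  0 <= gap (exp (- 2 * (eta - L / (2 * nu) * x))) x y P1 P2 Q1 Q2.
Proof.
  intros Hnu x y P1 P2 Q1 Q2 Hpole.
  destruct (root_sym_spec nu a b c w k) as [H1 [H2 H3]].
  unfold rho. rewrite (symbol_components nu a b c w k x y p q Hnu H2 H3).
  fold P1 P2 Q1 Q2. rewrite (surjective_pairing (root_sym nu a b c w k)). fold x y.
  set (g1 := gre x y P1 Q1 Q2) in *. set (g2 := gim x y P2 Q1 Q2) in *.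
  set (N := ((g1, g2) - (x, y))%C). set (D := ((g1, g2) + (x, y))%C).
  assert (HD : D <> 0%C).
  { intros HD. apply Hpole. unfold D, Cplus in HD; simpl in HD. injection HD. intros; split; lra. }
  rewrite Cmod_mult, Cmod_div by exact HD. rewrite Cmod_cexp.
  replace (Re (RtoC (- (L / (2 * nu))) * (x, y))%C) with (- (L / (2 * nu) * x)) by (simpl; ring).
  set (l := L / (2 * nu)).
  assert (HDp : 0 < Cmod D) by (apply Cmod_gt_0; exact HD).
  assert (HN : Cmod N * Cmod N = (g1 - x) * (g1 - x) + (g2 - y) * (g2 - y)).
  { rewrite Cmod_sqr. unfold N; simpl. ring. }
  assert (HD2 : Cmod D * Cmod D = (g1 + x) * (g1 + x) + (g2 + y) * (g2 + y)).
  { rewrite Cmod_sqr. unfold D; simpl. ring. }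
  unfold gap. fold g1 g2. rewrite <- HN, <- HD2.
  set (e := exp (- (eta - l * x))).
  assert (He : exp (- 2 * (eta - l * x)) = e * e).
  { unfold e. rewrite <- exp_plus. f_equal. ring. }
  assert (Hep : 0 < e) by apply exp_pos.
  assert (Hee : exp (- eta) = e * exp (- (l * x))).
  { unfold e. rewrite <- exp_plus. f_equal. ring. }
  rewrite He, Hee. pose proof (exp_pos (- (l * x))) as Hlx. pose proof (Cmod_ge_0 N) as HN0.
  assert (HeD : 0 < e * Cmod D) by (apply Rmult_lt_0_compat; lra).
  split; intros H.
  - apply Rmult_le_reg_r in H; [|exact Hlx].
    apply Rmult_le_compat_r with (r := Cmod D) in H; [|lra].
    replace (Cmod N / Cmod D * Cmod D) with (Cmod N) in H by (field; lra).
    assert (Cmod N * Cmod N <= (e * Cmod D) * (e * Cmod D)) by (apply Rmult_le_compat; lra).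
    lra.
  - apply Rmult_le_compat_r; [lra|].
    assert (Cmod N <= e * Cmod D) by (apply Rle_of_sqr_le; lra).
    apply Rmult_le_reg_r with (Cmod D); [exact HDp|].
    replace (Cmod N / Cmod D * Cmod D) with (Cmod N) by (field; lra). lra.
Qed.

Lemma rho_le_of_gap (nu a b c w k L eta : R) (p q : C) :
  0 < nu ->
  let x := fst (root_sym nu a b c w k) in
  let y := snd (root_sym nu a b c w k) in
  0 < x ->
  0 <= gap (exp (- 2 * (eta - L / (2 * nu) * x))) x y
    (fst p - fst q * x0sq nu a b / (4 * nu)) (snd p - snd q * x0sq nu a b / (4 * nu))
    (fst q / (4 * nu)) (snd q / (4 * nu)) ->
  Cmod (rho nu a b c w k p q L) <= exp (- eta).
Proof.
  intros Hnu x y Hx Hg. apply rho_le_iff_gap; [exact Hnu | | exact Hg]. fold x y.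
  unfold gap in Hg. fold x y in Hg. set (g1 := gre _ _ _ _ _) in *. set (g2 := gim _ _ _ _ _) in *.
  intros [H1 H2]. replace g1 with (- x) in Hg by lra. replace g2 with (- y) in Hg by lra.
  pose proof (Rle_0_sqr y). unfold Rsqr in *. assert (0 < x * x) by nra. lra.
Qed.

(** With [k], hence [t = Re S^2], fixed, the product is [x y = 2 nu (w + c k)]: moving [y] moves [w]
    in the same direction. *)
Lemma mul_sqrt_mono (t y y' : R) :
  0 <= t -> y <= y' -> sqrt (t + y * y) * y <= sqrt (t + y' * y') * y'.
Proof.
  intros Ht Hy. pose proof (sqrt_pos (t + y * y)). pose proof (sqrt_pos (t + y' * y')).
  destruct (Rle_lt_dec 0 y) as [H1|H1].
  - apply Rmult_le_compat; try lra. apply sqrt_le_1_alt. nra.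
  - destruct (Rle_lt_dec 0 y') as [H2|H2]; [nra|].
    assert (sqrt (t + y' * y') <= sqrt (t + y * y)) by (apply sqrt_le_1_alt; nra). nra.
Qed.

(* Two poles [S0], [Sn] of the same rational function satisfy [Q (S0 + Sn) = -1]. *)
Lemma third_pole (P Q S0 S1 S2 : C) :
  (P + Q * (S0 * S0) + S0 = 0)%C -> (P + Q * (S1 * S1) + S1 = 0)%C ->
  (P + Q * (S2 * S2) + S2 = 0)%C -> S1 <> S0 -> S2 <> S0 -> S1 = S2.
Proof.
  intros H0 H1 H2 N1 N2.
  assert (Hinj : forall u v : C, (u * v = 0)%C -> u <> 0%C -> v = 0%C).
  { intros u v Huv Hu. replace v with (/ u * (u * v))%C by (field; exact Hu).
    rewrite Huv. ring. }
  assert (Hsub : forall u v : C, u <> v -> (u - v <> 0)%C).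
  { intros u v Huv H. apply Huv. replace u with (u - v + v)%C by ring. rewrite H. ring. }
  assert (E1 : (Q * (S1 + S0) + 1 = 0)%C).
  { apply (Hinj (S1 - S0)%C); [|apply Hsub, N1].
    replace ((S1 - S0) * (Q * (S1 + S0) + 1))%C with
      ((P + Q * (S1 * S1) + S1) - (P + Q * (S0 * S0) + S0))%C by ring.
    rewrite H0, H1. ring. }
  assert (E2 : (Q * (S2 + S0) + 1 = 0)%C).
  { apply (Hinj (S2 - S0)%C); [|apply Hsub, N2].
    replace ((S2 - S0) * (Q * (S2 + S0) + 1))%C with
      ((P + Q * (S2 * S2) + S2) - (P + Q * (S0 * S0) + S0))%C by ring.
    rewrite H0, H2. ring. }
  assert (HQ : Q <> 0%C).
  { intros HQ. rewrite HQ in E1. replace (0 * (S1 + S0) + 1)%C with (RtoC 1) in E1 by ring.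
    apply RtoC_inj in E1. lra. }
  assert (E3 : (S1 - S2 = 0)%C).
  { apply (Hinj Q); [|exact HQ].
    replace (Q * (S1 - S2))%C with ((Q * (S1 + S0) + 1) - (Q * (S2 + S0) + 1))%C by ring.
    rewrite E1, E2. ring. }
  replace S1 with (S1 - S2 + S2)%C by ring. rewrite E3. ring.
Qed.

Lemma pole_complex (x y P1 P2 Q1 Q2 : R) :
  gre x y P1 Q1 Q2 + x = 0 -> gim x y P2 Q1 Q2 + y = 0 ->
  ((P1, P2) + (Q1, Q2) * ((x, y) * (x, y)) + (x, y) = 0)%C.
Proof.
  unfold gre, gim. intros H1 H2. unfold Cplus, Cmult, RtoC; simpl. f_equal; lra.
Qed.

(* At a pole the division convention makes [rho = 0]; the inequality at a pole is the limit of
   those at the nearby points with the same [k], which are not poles. *)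
Lemma feas_of_rho_le (nu a b c km wm L eta : R) (p q : C) :
  0 < nu -> 0 <= b -> 0 <= km -> 0 < wm ->
  (forall w k, InD km wm w k -> Cmod (rho nu a b c w k p q L) <= exp (- eta)) ->
  feas (Sregion nu a b c km wm) (L / (2 * nu)) eta
    (fst p - fst q * x0sq nu a b / (4 * nu)) (snd p - snd q * x0sq nu a b / (4 * nu))
    (fst q / (4 * nu)) (snd q / (4 * nu)).
Proof.
  intros Hnu Hb Hkm Hwm Hrho.
  set (P1 := fst p - _). set (P2 := snd p - _). set (Q1 := fst q / _). set (Q2 := snd q / _).
  set (l := L / (2 * nu)).
  assert (Hreg : forall w k x y, InD km wm w k -> 0 <= x ->
    x * x - y * y = x0sq nu a b + 4 * nu ^ 2 * k ^ 2 -> x * y = 2 * nu * (w + c * k) ->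
    ~ (gre x y P1 Q1 Q2 + x = 0 /\ gim x y P2 Q1 Q2 + y = 0) ->
    0 <= gap (exp (- 2 * (eta - l * x))) x y P1 P2 Q1 Q2).
  { intros w k x y HD Hx H1 H2 Hp.
    pose proof (root_sym_eq nu a b c km wm w k x y Hnu Hb Hkm Hwm HD Hx H1 H2) as ES.
    pose proof (rho_le_iff_gap nu a b c w k L eta p q Hnu) as Hiff. rewrite ES in Hiff.
    cbn [fst snd] in Hiff. apply Hiff; [exact Hp | apply Hrho, HD]. }
  intros x y [Hx [w [k [HD [H1 H2]]]]] _.
  destruct (Classical_Prop.classic (gre x y P1 Q1 Q2 + x = 0 /\ gim x y P2 Q1 Q2 + y = 0))
    as [[G1 G2]|Hp]; [|apply (Hreg w k); auto; lra].
  set (t := x0sq nu a b + 4 * nu ^ 2 * k ^ 2) in *.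
  assert (Ht : 0 <= t).
  { unfold t, x0sq. pose proof (pow2_ge_0 a). pose proof (pow2_ge_0 (2 * nu * k)).
    assert (0 <= nu * b) by (apply Rmult_le_pos; lra). lra. }
  assert (Ex : x = sqrt (t + y * y)).
  { replace (t + y * y) with (Rsqr x) by (unfold Rsqr; lra). symmetry. apply sqrt_Rsqr; lra. }
  (* The approach is from the side on which [|w|] is larger, so the nearby points stay in the
     domain. *)
  set (sg := if Rle_dec 0 w then 1 else -1).
  set (v := fun n : nat => y + sg * / (INR n + 1)).
  set (u := fun n : nat => sqrt (t + v n * v n)).
  assert (Hinv : forall n : nat, 0 < / (INR n + 1)).
  { intros n. apply Rinv_0_lt_compat. pose proof (pos_INR n). lra. }
  assert (Lv : is_lim_seq v y).
  { replace (Finite y) with (Finite (y + sg * 0)) by (f_equal; ring).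
    unfold v. pose proof is_lim_seq_inv_succ. lim. }
  assert (Lu : is_lim_seq u x).
  { rewrite Ex. unfold u. apply (is_lim_seq_continuous sqrt (fun n => t + v n * v n)); [|lim].
    apply continuity_pt_sqrt. nra. }
  assert (Hu2 : forall n, u n * u n = t + v n * v n).
  { intros n. apply sqrt_sqrt. pose proof (Rle_0_sqr (v n)). unfold Rsqr in *. lra. }
  assert (HDn : forall n, InD km wm (u n * v n / (2 * nu) - c * k) k).
  { intros n. destruct HD as [HD1 HD2]. split; [|exact HD2].
    eapply Rle_trans; [exact HD1|].
    assert (Ew : w = x * y / (2 * nu) - c * k) by (rewrite H2; field; lra).
    unfold sg in *. destruct (Rle_dec 0 w) as [Hw|Hw].
    - assert (x * y <= u n * v n).
      { rewrite Ex. apply mul_sqrt_mono; [exact Ht|]. unfold v. specialize (Hinv n). lra. }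
      assert (x * y / (2 * nu) <= u n * v n / (2 * nu)) by
        (apply Rmult_le_compat_r; [apply Rlt_le, Rinv_0_lt_compat; lra | lra]).
      rewrite (Rabs_pos_eq w) by lra. eapply Rle_trans; [|apply Rle_abs]. lra.
    - assert (u n * v n <= x * y).
      { rewrite Ex. apply mul_sqrt_mono; [exact Ht|]. unfold v. specialize (Hinv n). lra. }
      assert (u n * v n / (2 * nu) <= x * y / (2 * nu)) by
        (apply Rmult_le_compat_r; [apply Rlt_le, Rinv_0_lt_compat; lra | lra]).
      rewrite !Rabs_left by lra. lra. }
  assert (Hsg : sg <> 0) by (unfold sg; destruct (Rle_dec 0 w); lra).
  assert (Hvinj : forall n n', v n = v n' -> n = n').
  { intros n n' Hv. apply INR_eq. apply Rplus_eq_reg_r with 1.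
    rewrite <- (Rinv_inv (INR n + 1)), <- (Rinv_inv (INR n' + 1)). f_equal.
    apply Rmult_eq_reg_l with sg; [unfold v in Hv; lra | exact Hsg]. }
  assert (Hvy : forall n, v n <> y).
  { intros n Hv. unfold v in Hv. specialize (Hinv n).
    assert (Hz : sg * / (INR n + 1) = 0) by lra.
    apply Rmult_integral in Hz. destruct Hz; lra. }
  set (pole := fun n => gre (u n) (v n) P1 Q1 Q2 + u n = 0 /\ gim (u n) (v n) P2 Q1 Q2 + v n = 0).
  (* [(x, y)] is a pole and differs from every [(u n, v n)], so [third_pole] leaves at most one
     further pole along the sequence. *)
  assert (Hev : exists N, forall n, (N <= n)%nat -> ~ pole n).
  { destruct (Classical_Prop.classic (exists N, pole N)) as [[N HN]|HN].
    - exists (S N). intros n Hn Hpn.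
      assert (ES : (u N, v N) = (u n, v n)).
      { apply (third_pole (P1, P2) (Q1, Q2) (x, y)).
        - apply pole_complex; assumption.
        - apply pole_complex; apply HN.
        - apply pole_complex; apply Hpn.
        - intros E; injection E; intros; apply (Hvy N); assumption.
        - intros E; injection E; intros; apply (Hvy n); assumption. }
      injection ES. intros Ev _. apply Hvinj in Ev. lia.
    - exists O. intros n _ Hpn. apply HN. exists n; exact Hpn. }
  destruct Hev as [N HN].
  apply is_lim_seq_nonneg with (u := fun n => gap (exp (- 2 * (eta - l * u n))) (u n) (v n) P1 P2 Q1 Q2).
  - exists N. intros n Hn. apply (Hreg (u n * v n / (2 * nu) - c * k) k).
    + apply HDn.
    + apply sqrt_pos.
    + rewrite Hu2. fold t. ring.
    + field. lra.
    + apply HN, Hn.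
  - unfold gap, gre, gim. lim.
Qed.

(** * Asymptotics *)

Lemma Rpower_fifth (x : R) : 0 < x -> Rpower x (1 / 5) ^ 5 = x.
Proof.
  intros Hx. rewrite <- Rpower_pow by apply exp_pos. rewrite Rpower_mult.
  replace (1 / 5 * INR 5) with 1 by (simpl; field). apply Rpower_1, Hx.
Qed.

Lemma Rpower_fifth_eq (x y : R) : 0 < y -> x = y ^ 5 -> Rpower x (1 / 5) = y.
Proof.
  intros Hy ->. rewrite <- Rpower_pow by exact Hy. rewrite Rpower_mult.
  replace (INR 5 * (1 / 5)) with 1 by (simpl; field). apply Rpower_1, Hy.
Qed.

Lemma pow5_le_inv (x y : R) : 0 < y -> x ^ 5 <= y ^ 5 -> x <= y.
Proof.
  intros Hy H. destruct (Rle_lt_dec x y) as [|Hlt]; [assumption | exfalso].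
  assert (0 < y ^ 4) by (apply pow_lt; lra).
  assert (y ^ 4 <= x ^ 4) by (apply pow_incr; lra).
  assert (y * y ^ 4 < x * y ^ 4) by (apply Rmult_lt_compat_r; lra).
  assert (x * y ^ 4 <= x * x ^ 4) by (apply Rmult_le_compat_l; lra).
  simpl in *; lra.
Qed.

Lemma filterlim_real_to_one (f : R -> C) (r : R -> R) :
  (forall eps, 0 < eps < 1 -> exists d, 0 < d /\ forall L, 0 < L < d ->
     f L = RtoC (r L) /\ Rabs (r L - 1) <= eps) ->
  filterlim f (at_right 0) (locally (RtoC 1)).
Proof.
  intros H. apply filterlim_locally. intros eps.
  assert (He : 0 < Rmin (eps / 2) (1 / 2)) by
    (apply Rmin_pos; [apply Rdiv_lt_0_compat; [apply cond_pos | lra] | lra]).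
  pose proof (Rmin_l (eps / 2) (1 / 2)). pose proof (Rmin_r (eps / 2) (1 / 2)).
  destruct (H (Rmin (eps / 2) (1 / 2)) ltac:(lra)) as [d [Hd HL]].
  exists (mkposreal d Hd). intros L HLd HL0.
  assert (HL' : L < d).
  { unfold ball in HLd; simpl in HLd; unfold AbsRing_ball, minus, plus, opp, abs in HLd; simpl in HLd.
    apply Rabs_def2 in HLd. lra. }
  destruct (HL L (conj HL0 HL')) as [-> Hr].
  pose proof (cond_pos eps).
  split; simpl.
  - unfold ball; simpl. unfold AbsRing_ball, minus, plus, opp, abs; simpl.
    unfold Rminus in Hr. lra.
  - apply ball_center.
Qed.

(** An optimal [eta] below [(1 - eps/16) h] would be beaten by the scaled pair, so
    [feasible_asymptotics] applies to every optimum. *)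
Lemma optimal_asymptotics (Sset : R -> R -> Prop) (m t0 X0 eps : R) :
  symbol_region Sset m t0 X0 -> 0 < eps < 1 ->
  exists h0, 0 < h0 /\ forall h P Q eta, 0 < h <= h0 -> optimal_at Sset m h P Q eta ->
    Rabs (P * h / (2 * m) - 1) <= eps /\ Rabs (16 * m * Q / h ^ 3 - 1) <= eps /\
    Rabs (eta / h - 1) <= eps.
Proof.
  intros HS He. destruct (feasible_asymptotics Sset m t0 X0 eps HS He) as [h0 [Hh0 Has]].
  pose proof (sr_pos _ _ _ _ HS) as Hm.
  exists (Rmin h0 (eps / 16 * (eps / 16) / 64)). split.
  { apply Rmin_pos; [exact Hh0|]. nra. }
  intros h P Q eta Hh [HP [HQ [Heta [HF [Hopt _]]]]].
  assert (H1 : h <= h0) by (eapply Rle_trans; [apply Hh | apply Rmin_l]).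
  assert (H2 : h <= eps / 16 * (eps / 16) / 64) by (eapply Rle_trans; [apply Hh | apply Rmin_r]).
  apply (Has h eta P 0 Q 0); [lra | | exact HF].
  apply Rnot_lt_le. intros Hlt.
  apply (Hopt _ (2 * m / h) 0 (h ^ 3 / (16 * m)) 0 Hlt).
  apply scaling_test_feasible; [exact Hm | apply (sr_bounds _ _ _ _ HS) | lra | lra | exact H2].
Qed.

Lemma one_minus_exp_bounds (eta : R) : 0 < eta -> eta - eta * eta <= 1 - exp (- eta) <= eta.
Proof.
  intros He. pose proof (exp_ineq1_le (- eta)). pose proof (exp_ineq1_le eta).
  assert (exp (- eta) * exp eta = 1) by
    (rewrite <- exp_plus; replace (- eta + eta) with 0 by ring; apply exp_0).
  pose proof (exp_pos (- eta)). split; [|lra].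
  assert (exp (- eta) * (1 + eta) <= 1) by nra.
  destruct (Rle_lt_dec (exp (- eta)) (1 - eta + eta * eta)) as [|Hlt]; [lra | exfalso].
  assert ((1 - eta + eta * eta) * (1 + eta) < exp (- eta) * (1 + eta)) by
    (apply Rmult_lt_compat_r; lra).
  assert (0 < eta * (eta * eta)) by (repeat apply Rmult_lt_0_compat; lra). lra.
Qed.

Theorem theorem5 (nu b a c km wm : R) :
  0 < nu -> 0 <= b -> 0 <= km -> 0 < wm ->
  let A := Aconst nu a b c km wm in
  exists L0 : R, 0 < L0 /\
  exists (pS qS : R -> C) (dS : R -> R),
    (forall L : R, 0 < L < L0 ->
       (* dS L is the sup over D^infty of |rho(., ., pS L, qS L, L)| *)
       is_lub (fun r => exists w k, InD km wm w k /\
                 r = Cmod (rho nu a b c w k (pS L) (qS L) L)) (dS L) /\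
       (* every other (p,q) in C^2 has a strictly larger sup: (pS L, qS L)
          is the unique minimizer and dS L the minimal value *)
       (forall p q : C, (p, q) <> (pS L, qS L) ->
          exists w k, InD km wm w k /\
            dS L < Cmod (rho nu a b c w k p q L))) /\
    filterlim (fun L => (pS L / RtoC (1 / 2 * Rpower (nu * A ^ 4 / (8 * L)) (1 / 5)))%C)
      (at_right 0) (locally (RtoC 1)) /\
    filterlim (fun L => (qS L / RtoC (4 * Rpower (nu ^ 2 * L ^ 3 / (2 * A ^ 2)) (1 / 5)))%C)
      (at_right 0) (locally (RtoC 1)) /\
    filterlim (fun L => (RtoC (1 - dS L) / (RtoC A / (2 * pS L)))%C)
      (at_right 0) (locally (RtoC 1)).
Proof.
  intros Hnu Hb Hkm Hwm A.
  destruct (Sregion_symbol_region nu a b c km wm Hnu Hb Hkm Hwm) as [t0 [X0 HS]].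
  fold A in HS. set (m := A / 4) in *. set (Sset := Sregion nu a b c km wm) in *.
  pose proof (sr_pos _ _ _ _ HS) as Hm.
  assert (HA : 0 < A) by (unfold m in Hm; lra).
  assert (Hx0 : 0 <= x0sq nu a b).
  { unfold x0sq. pose proof (pow2_ge_0 a). assert (0 <= nu * b) by (apply Rmult_le_pos; lra). lra. }
  set (x0 := x0sq nu a b) in *.
  set (h := fun L => Rpower (8 * A * L / nu) (1 / 5)).
  assert (Hhpos : forall L, 0 < h L) by (intros; apply exp_pos).
  assert (Hh5 : forall L, 0 < L -> h L ^ 5 = 8 * A * L / nu).
  { intros L HL. apply Rpower_fifth. apply Rdiv_lt_0_compat; [|lra].
    repeat apply Rmult_lt_0_compat; lra. }
  assert (Hhl : forall L, 0 < L -> h L ^ 5 / (64 * m) = L / (2 * nu)).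
  { intros L HL. rewrite (Hh5 L HL). unfold m. field. lra. }
  assert (Hsmall : forall h0, 0 < h0 -> exists d, 0 < d /\ forall L, 0 < L < d -> 0 < h L <= h0).
  { intros h0 Hh0. exists (nu * h0 ^ 5 / (8 * A)).
    assert (0 < h0 ^ 5) by (apply pow_lt; lra). split.
    - apply Rdiv_lt_0_compat; [apply Rmult_lt_0_compat; lra | lra].
    - intros L HL. split; [apply Hhpos|]. apply pow5_le_inv; [exact Hh0|].
      rewrite (Hh5 L) by lra. apply Rmult_le_reg_r with (nu / (8 * A)).
      + apply Rdiv_lt_0_compat; lra.
      + replace (8 * A * L / nu * (nu / (8 * A))) with L by (field; lra).
        replace (h0 ^ 5 * (nu / (8 * A))) with (nu * h0 ^ 5 / (8 * A)) by (field; lra). lra. }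
  destruct (abstract_best_approximation Sset m t0 X0 HS) as [h0 [Hh0 Habs]].
  destruct (Hsmall h0 Hh0) as [L0 [HL0 HhL0]].
  assert (Hex : forall L, exists z : R * R * R, 0 < L < L0 ->
    optimal_at Sset m (h L) (fst (fst z)) (snd (fst z)) (snd z)).
  { intros L. destruct (Classical_Prop.classic (0 < L < L0)) as [HL|HL].
    - destruct (Habs (h L) (HhL0 L HL)) as [P [Q [eta HH]]].
      exists (P, Q, eta). intros _. exact HH.
    - exists (0, 0, 0). intros HL'. contradiction. }
  set (z := fun L => proj1_sig (constructive_indefinite_description _ (Hex L))).
  set (P := fun L => fst (fst (z L))). set (Q := fun L => snd (fst (z L))). set (eta := fun L => snd (z L)).
  assert (Hopt : forall L, 0 < L < L0 -> optimal_at Sset m (h L) (P L) (Q L) (eta L)).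
  { intros L. unfold P, Q, eta, z. destruct constructive_indefinite_description; assumption. }
  clearbody P Q eta. clear z Hex.
  (* Inverse of the change of unknowns, on real coefficients. *)
  set (pr := fun L => P L + Q L * x0). set (qr := fun L => 4 * nu * Q L).
  exists L0. split; [exact HL0|].
  exists (fun L => RtoC (pr L)), (fun L => RtoC (qr L)), (fun L => exp (- eta L)).
  split.
  { intros L HL. destruct (Hopt L HL) as [HP [HQ [Heta [HF [Hmax Huniq]]]]].
    rewrite (Hhl L) in HF, Hmax, Huniq by lra.
    assert (EP : pr L - qr L * x0 / (4 * nu) = P L) by (unfold pr, qr; field; lra).
    assert (EQ : qr L / (4 * nu) = Q L) by (unfold qr; field; lra).
    split.
    - split.
      + intros r [w [k [HD ->]]].
        pose proof (root_sym_Sregion nu a b c km wm w k Hnu Hb Hkm Hwm HD) as HSr.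
        destruct (sr_bounds _ _ _ _ HS _ _ HSr) as [Hxm Hyx].
        apply rho_le_of_gap; [exact Hnu | lra|].
        cbn [fst snd RtoC]. fold x0. rewrite EP, EQ.
        replace (0 - 0 * x0 / (4 * nu)) with 0 by (field; lra).
        replace (0 / (4 * nu)) with 0 by (field; lra).
        destruct (Rlt_le_dec (L / (2 * nu) * fst (root_sym nu a b c w k)) (eta L)) as [Hlt|Hge].
        * apply HF; assumption.
        * apply Rlt_le, gap_real_pos_of_ge1; try lra.
          rewrite <- exp_0. destruct Hge as [Hge|Hge]; [left; apply exp_increasing; lra|].
          rewrite <- Hge. right. f_equal. ring.
      + intros r Hr. apply Rnot_lt_le. intros Hlt.
        (* [r] is not known to be positive; [r'] is, and it is still below [exp (- eta L)], so
           [- ln r'] exceeds the optimal exponent. *)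
        set (r' := Rmax r (exp (- eta L - 1))).
        assert (Hr'0 : 0 < r') by (eapply Rlt_le_trans; [apply exp_pos | apply Rmax_r]).
        assert (Hr'1 : r' < exp (- eta L)).
        { apply Rmax_lub_lt; [exact Hlt | apply exp_increasing; lra]. }
        apply (Hmax (- ln r') (pr L - qr L * x0 / (4 * nu)) (0 - 0 * x0 / (4 * nu))
          (qr L / (4 * nu)) (0 / (4 * nu))).
        * assert (ln r' < ln (exp (- eta L))) by (apply ln_increasing; assumption).
          rewrite ln_exp in H. lra.
        * apply (feas_of_rho_le nu a b c km wm L (- ln r') (RtoC (pr L)) (RtoC (qr L))); auto.
          intros w k HD. rewrite Ropp_involutive, exp_ln by exact Hr'0.
          eapply Rle_trans; [|apply Rmax_l]. apply Hr. exists w, k. auto.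
    (* If [|rho|] nowhere exceeded [exp (- eta L)], the pair would be feasible at the optimal
       exponent and hence be the optimum. *)
    - intros p q Hpq. apply Classical_Prop.NNPP. intros Hno. apply Hpq.
      assert (HFpq := feas_of_rho_le nu a b c km wm L (eta L) p q Hnu Hb Hkm Hwm).
      destruct (Huniq _ _ _ _ (HFpq ltac:(intros w k HD; apply Rnot_lt_le; intros Hlt;
        apply Hno; exists w, k; auto))) as [E1 [E2 [E3 E4]]].
      fold x0 in E1, E2. destruct p as [p1 p2], q as [q1 q2]. cbn [fst snd] in *.
      assert (Eq1 : q1 = qr L) by (unfold qr; rewrite <- E3; field; lra).
      assert (Eq2 : q2 = 0).
      { replace q2 with (4 * nu * (q2 / (4 * nu))) by (field; lra). rewrite E4. ring. }
      subst q1 q2.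
      assert (Ep1 : p1 = pr L) by lra.
      assert (Ep2 : p2 = 0).
      { replace (0 * x0 / (4 * nu)) with 0 in E2 by (field; lra). lra. }
      subst p1 p2. reflexivity. }
  assert (Hlim : forall eps, 0 < eps < 1 -> exists d, 0 < d /\ forall L, 0 < L < d ->
    0 < L < L0 /\ 
    Rabs (pr L * h L / (2 * m) - 1) <= eps /\ Rabs (16 * m * Q L / h L ^ 3 - 1) <= eps /\
    Rabs (eta L / h L - 1) <= eps /\ h L <= eps).
  { intros eps He.
    destruct (optimal_asymptotics Sset m t0 X0 (eps / 2) HS ltac:(lra)) as [h1 [Hh1 Has]].
    set (h2 := Rmin h1 (Rmin eps (16 * (m * m) * eps / (2 * (x0 + 1))))).
    assert (Hmm : 0 < m * m) by nra.
    assert (Hh2 : 0 < h2).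
    { unfold h2. repeat apply Rmin_pos; try lra. apply Rdiv_lt_0_compat; [|lra].
      apply Rmult_lt_0_compat; lra. }
    destruct (Hsmall h2 Hh2) as [d [Hd HLd]].
    exists (Rmin d L0). split; [apply Rmin_pos; assumption|].
    intros L HL. assert (HLL0 : 0 < L < L0) by (pose proof (Rmin_r d L0); lra).
    destruct (HLd L ltac:(pose proof (Rmin_l d L0); lra)) as [Hh Hhle].
    destruct (Has (h L) (P L) (Q L) (eta L)
      ltac:(split; [exact Hh | eapply Rle_trans; [exact Hhle | apply Rmin_l]]) (Hopt L HLL0)) as [H1 [H2 H3]].
    assert (Hhe : h L <= eps).
    { eapply Rle_trans; [exact Hhle|]. eapply Rle_trans; [apply Rmin_r | apply Rmin_l]. }
    assert (Hhx : h L <= 16 * (m * m) * eps / (2 * (x0 + 1))).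
    { eapply Rle_trans; [exact Hhle|]. eapply Rle_trans; [apply Rmin_r | apply Rmin_r]. }
    split; [exact HLL0|]. split; [|repeat split; lra].
    set (hh := h L) in *. set (v := 16 * m * Q L / hh ^ 3) in *.
    assert (Hh3 : 0 < hh ^ 3) by (apply pow_lt; lra).
    (* [p] exceeds [P] by [Q x0], a relative correction of order [h^4]; the third bound in [h2]
       keeps it below [eps / 2]. *)
    replace (pr L * hh / (2 * m)) with (P L * hh / (2 * m) + v * (hh * hh ^ 3 * x0) / (32 * (m * m))) by
      (unfold pr, v; field; lra).
    apply Rabs_le_between in H1. apply Rabs_le_between in H2.
    assert (Hhx' : hh * x0 <= 8 * (m * m) * eps).
    { apply Rmult_le_compat_r with (r := 2 * (x0 + 1)) in Hhx; [|lra].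
      replace (16 * (m * m) * eps / (2 * (x0 + 1)) * (2 * (x0 + 1))) with (16 * (m * m) * eps) in Hhx by
        (field; lra). lra. }
    assert (Hh31 : hh ^ 3 <= 1) by (rewrite <- (pow1 3); apply pow_incr; lra).
    assert (Hhx0 : 0 <= hh * x0) by (apply Rmult_le_pos; lra).
    assert (Ht1 : 0 <= v * (hh * hh ^ 3 * x0) <= 2 * (8 * (m * m) * eps)).
    { replace (hh * hh ^ 3 * x0) with (hh ^ 3 * (hh * x0)) by ring.
      assert (0 <= hh ^ 3 * (hh * x0)) by (apply Rmult_le_pos; lra).
      assert (hh ^ 3 * (hh * x0) <= 1 * (hh * x0)) by (apply Rmult_le_compat_r; lra).
      split; [apply Rmult_le_pos; lra|]. apply Rmult_le_compat; lra. }
    assert (Ht2 : 0 <= v * (hh * hh ^ 3 * x0) / (32 * (m * m)) <= eps / 2).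
    { split.
      - apply Rmult_le_pos; [lra | apply Rlt_le, Rinv_0_lt_compat; lra].
      - apply Rmult_le_reg_r with (32 * (m * m)); [lra|].
        replace (v * (hh * hh ^ 3 * x0) / (32 * (m * m)) * (32 * (m * m))) with
          (v * (hh * hh ^ 3 * x0)) by (field; lra). lra. }
    apply Rabs_le; lra. }
  split; [|split].
  - apply filterlim_real_to_one with (r := fun L => pr L * h L / (2 * m)).
    intros eps He. destruct (Hlim eps He) as [d [Hd HL]]. exists d. split; [exact Hd|].
    intros L HLd. destruct (HL L HLd) as [HL' [H1 _]]. split; [|exact H1].
    assert (Hp : Rpower (nu * A ^ 4 / (8 * L)) (1 / 5) = A / h L).
    { pose proof (Hhpos L). apply Rpower_fifth_eq; [apply Rdiv_lt_0_compat; lra|].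
      replace ((A / h L) ^ 5) with (A ^ 5 / h L ^ 5) by (field; lra).
      rewrite (Hh5 L) by lra. field. lra. }
    rewrite Hp. pose proof (Hhpos L). rewrite <- RtoC_div.
    + f_equal. unfold m. field. lra.
    + apply Rgt_not_eq, Rmult_lt_0_compat; [lra | apply Rdiv_lt_0_compat; lra].
  - apply filterlim_real_to_one with (r := fun L => 16 * m * Q L / h L ^ 3).
    intros eps He. destruct (Hlim eps He) as [d [Hd HL]]. exists d. split; [exact Hd|].
    intros L HLd. destruct (HL L HLd) as [HL' [_ [H1 _]]]. split; [|exact H1].
    pose proof (Hhpos L) as Hh.
    assert (Hh3 : 0 < h L ^ 3) by (apply pow_lt; lra).
    assert (Hy : 0 < nu * h L ^ 3 / (4 * A)) by
      (apply Rdiv_lt_0_compat; [apply Rmult_lt_0_compat; lra | lra]).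
    assert (Hp : Rpower (nu ^ 2 * L ^ 3 / (2 * A ^ 2)) (1 / 5) = nu * h L ^ 3 / (4 * A)).
    { apply Rpower_fifth_eq; [exact Hy|].
      replace ((nu * h L ^ 3 / (4 * A)) ^ 5) with (nu ^ 5 * (h L ^ 5) ^ 3 / (1024 * A ^ 5)) by (field; lra).
      rewrite (Hh5 L) by lra. field. lra. }
    rewrite Hp. rewrite <- RtoC_div by lra.
    f_equal. unfold qr, m. field. lra.
  (* Because [A = 4m], the quotient factors into [(1 - exp (- eta))/h], which tends to 1 like
     [eta/h], and the normalised [p]. *)
  - apply filterlim_real_to_one with (r := fun L =>
      ((1 - exp (- eta L)) / h L) * (pr L * h L / (2 * m))).
    intros eps He. destruct (Hlim (eps / 20) ltac:(lra)) as [d [Hd HL]]. exists d. split; [exact Hd|].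
    intros L HLd. destruct (HL L HLd) as [HL' [H1 [_ [H3 H4]]]].
    pose proof (Hhpos L) as Hh. destruct (Hopt L HL') as [HP [HQ [Heta _]]].
    assert (Hpr : 0 < pr L).
    { unfold pr. assert (0 <= Q L * x0) by (apply Rmult_le_pos; lra). lra. }
    split.
    + rewrite <- RtoC_mult, <- RtoC_div by lra. rewrite <- RtoC_div.
      * f_equal. unfold m. field. lra.
      * apply Rgt_not_eq, Rdiv_lt_0_compat; lra.
    + destruct (one_minus_exp_bounds (eta L) Heta) as [Hl Hu].
      set (hh := h L) in *. set (e := eta L / hh) in *. set (f := (1 - exp (- eta L)) / hh).
      assert (Ee : eta L = e * hh) by (unfold e; field; lra).
      assert (Ef : 1 - exp (- eta L) = f * hh) by (unfold f; field; lra).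
      apply Rabs_le_between in H1. apply Rabs_le_between in H3.
      rewrite Ef, Ee in Hl, Hu.
      assert (Hfu : f <= e) by (apply Rmult_le_reg_r with hh; lra).
      assert (Hfl : e - e * e * hh <= f) by (apply Rmult_le_reg_r with hh; lra).
      assert (Hee : e * e * hh <= 4 * (eps / 20)) by (apply Rmult_le_compat; nra).
      set (s := eps / 20) in *. set (u := pr L * hh / (2 * m)) in *.
      assert (Hs : 0 < s < / 20) by (unfold s; lra).
      assert (Hf : -5 * s <= f - 1 <= s) by lra.
      replace eps with (20 * s) by (unfold s; field).
      replace (f * u - 1) with ((f - 1) * u + (u - 1)) by ring.
      apply Rabs_le. split; nra.
Qed.
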